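(* Let $p$ be an odd prime, $m\geq 3$ an integer, $l$ a positive integer with $\gcd(m,l)=1$, $q=p^m$, and $\mathrm{Tr}$ the trace from $\mathbb{F}_q$ onto $\mathbb{F}_p$. Let $$\mathcal{D}_2=\{(\mathrm{Tr}(ax^{p^l+1}+bx)+h)_{x\in\mathbb{F}_q}: a,b\in\mathbb{F}_q, h\in\mathbb{F}_p\}$$ with coordinates indexed by $\mathbb{F}_q$, and for each $i$ with $A_i\neq0$ let $\mathcal{B}$ be the set of supports of the codewords of $\mathcal{D}_2$ of weight $i$. Then for $m\geq 3$ odd, $(\mathbb{F}_q,\mathcal{B})$ is a $2$-$(p^m,i,\lambda)$ design for the following pairs $(i,\lambda)$: - $(p^m-p^{m-1},\ (p^m-p^{m-1}-1)(p^{m-1}+1))$; - $(p^m-p^{m-1}+p^{\frac{m-1}{2}},\ \frac{1}{2}p^{\frac{m-1}{2}}(p^{\frac{m+1}{2}}-p^{\frac{m-1}{2}}+1)(p^m-p^{m-1}+p^{\frac{m-1}{2}}-1))$; - $(p^m-p^{m-1}-p^{\frac{m-1}{2}},\ \frac{1}{2}p^{\frac{m-1}{2}}(p^{\frac{m+1}{2}}-p^{\frac{m-1}{2}}-1)(p^m-p^{m-1}-p^{\frac{m-1}{2}}-1))$. For $m\geq 4$ even, $(\mathbb{F}_q,\mathcal{B})$ is a $2$-$(p^m,i,\lambda)$ design for the following pairs $(i,\lambda)$: - $(p^m-p^{m-1},\ (p^m-p^{m-1}-1)(p^{m-1}-p^{m-2}+1))$; - $(p^{\frac{m}{2}-1}(p-1)(p^{\frac{m}{2}}-(-1)^{\frac{m}{2}}),\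 p^{\frac{m}{2}}(p^{\frac{m}{2}}-(-1)^{\frac{m}{2}})[p^{\frac{m}{2}-1}(p-1)(p^{\frac{m}{2}}-(-1)^{\frac{m}{2}})-1]/(p+1))$; - $(p^{\frac{m}{2}-1}[p^{\frac{m}{2}}(p-1)+(-1)^{\frac{m}{2}}],\ p^{\frac{m}{2}}[p^{\frac{m}{2}}(p-1)+(-1)^{\frac{m}{2}}][p^{m-1}(p-1)+(-1)^{\frac{m}{2}}p^{\frac{m}{2}-1}-1]/(p+1))$; - $(p^{\frac{m}{2}}(p-1)[p^{\frac{m}{2}-1}+(-1)^{\frac{m}{2}}],\ p^{\frac{m}{2}-2}[p^{\frac{m}{2}-1}+(-1)^{\frac{m}{2}}][p^{\frac{m}{2}}(p-1)(p^{\frac{m}{2}-1}+(-1)^{\frac{m}{2}})-1]/(p+1))$; - $(p^{\frac{m}{2}}[p^{\frac{m}{2}-1}(p-1)-(-1)^{\frac{m}{2}}],\ p^{\frac{m}{2}-2}[p^{\frac{m}{2}-1}(p-1)-(-1)^{\frac{m}{2}}][p^{m-1}(p-1)-(-1)^{\frac{m}{2}}p^{\frac{m}{2}}-1]/(p+1))$.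
   Context: The support of a codeword $(c_x)_{x\in\mathbb{F}_q}$ is $\{x: c_x\neq0\}$; $A_i$ is the number of codewords of Hamming weight $i$. A $2$-$(v,k,\lambda)$ design is a pair $(\mathcal{P},\mathcal{B})$ with $|\mathcal{P}|=v$ and $\mathcal{B}$ a set of $k$-subsets of $\mathcal{P}$ such that every $2$-subset of $\mathcal{P}$ lies in exactly $\lambda$ members of $\mathcal{B}$. In the paper $\mathcal{D}_2$ is denoted $\overline{\mathcal{C}_2^{\perp}}^{\perp}$. *)

(* Defs.v *)
From HB Require Import structures.
From mathcomp Require Import all_boot all_order all_algebra all_fingroup all_field.

Set Implicit Arguments.
Unset Strict Implicit.
Unset Printing Implicit Defensive.

Import GRing.Theory.
Local Open Scope ring_scope.

Definition is_2design (T : finType) (P : {set T}) (B : {set {set T}})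
    (v k lambda : nat) : Prop :=
  [/\ #|P| = v,
      forall X : {set T}, X \in B -> X \subset P /\ #|X| = k
    & forall S : {set T}, S \subset P -> #|S| = 2%N ->
        #|[set X in B | S \subset X]| = lambda].

Section Codes.

Variables (T : finType) (K : nmodType).

Definition supp (c : {ffun T -> K}) : {set T} := [set x | c x != 0].

Definition hweight (c : {ffun T -> K}) : nat := #|supp c|.

End Codes.

Section WeightClasses.

Variables (T : finType) (K : finNmodType) (C : {set {ffun T -> K}}).

Definition codewords_of_weight (i : nat) : {set {ffun T -> K}} :=
  [set c in C | hweight c == i].

Definition weight_number (i : nat) : nat := #|codewords_of_weight i|.

Definition supports_of_weight (i : nat) : {set {set T}} :=
  [set supp c | c in codewords_of_weight i].

(* The block size and the index are given by rational expressions, so their being natural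
   numbers is part of the assertion. *)
Definition supports_2design (v : nat) (i lambda : rat) : Prop :=
  exists k mu : nat,
    [/\ k%:R = i, mu%:R = lambda, weight_number k <> 0%N
      & is_2design [set: T] (supports_of_weight k) v k mu].

End WeightClasses.

Section CodeD2.

Variables (p : nat) (F : finFieldType) (charFp : p \in [pchar F]) (l : nat).

(* F_p is identified with the prime subfield of F: the trace takes its values
   there, and h : 'F_p is embedded as h%:R. *)
Definition Tr (x : F) : F :=
  galTrace 1%VS {: pPrimeCharType charFp} (x : pPrimeCharType charFp).

Definition codeword2 (a b : F) (h : 'F_p) : {ffun F -> F} :=
  [ffun x => Tr (a * x ^+ (p ^ l + 1)%N + b * x) + (h : nat)%:R].

Definition code_D2 : {set {ffun F -> F}} :=
  [set codeword2 t.1.1 t.1.2 t.2 | t : F * F * 'F_p].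

End CodeD2.

(* Main.v *)
Require Import Defs.
From HB Require Import structures.
From mathcomp Require Import all_boot all_order all_algebra all_fingroup all_solvable all_field.
From mathcomp Require Import zify ring lra.

(** The affine group AGL(1, q) is sharply 2-transitive on the coordinates and preserves the
    code, so the supports of the words of weight [i] form a 2-design, and double counting gives
    [lambda q (q - 1) = n i (i - 1)] with [n] the number of blocks.  Two words of weight [i]
    with the same support are proportional (otherwise some combination of them would be lighter
    than the minimum distance), so [n = A_i / (p - 1)], and only the weight distribution is
    needed.

    The word of [(a, b, h)] is [Q_a + tr (b _) + h], where [Q_a x = tr (a x^(p^l+1))] is a
    quadratic form.  Completing the square reduces its number of zeros to a value of
    [N_a t = #{x | Q_a x = t}], or to [q / p] when [b] is not in the image of the polar map.
    The second moment of [N_a] is given by the size of the radical [R_a], as [Q (x + u) - Q x]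
    is equidistributed for [u] outside [R_a].
    - For [m] odd, [R_a = 0]; for a nonsquare [g] of [F_p] the map [(u, x) |-> u x^(p^l+1)] on
      [{1, g} x F] is two-to-one, so [N_a t + N_a (g^-1 t) = 2 q / p].
    - For [m] even, [F_(p^2)] is a subfield of [F] whose units scale [Q_a] by their norms: hence
      [N_a] is constant outside [0] and [N_a 0 = 1] modulo [p^2 - 1].  The second moment then
      gives [N_a] up to a sign, the congruence gives the sign, and summing [N_a 0] over [a]
      gives the number of degenerate forms. *)

Set Implicit Arguments.
Unset Strict Implicit.
Unset Printing Implicit Defensive.

Import Order.TTheory GRing.Theory Num.Theory.
Local Open Scope ring_scope.

(** * The trace as a map to the prime field *)

Section PrimeFieldTrace.

Variables (p : nat) (F : finFieldType) (charFp : p \in [pchar F]).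

Lemma Fp_scale_natr (h : 'F_p) (x : pPrimeCharType charFp) : h *: x = (h : nat)%:R * x.
Proof. by []. Qed.

Lemma TrD : {morph Tr charFp : x y / x + y}.
Proof. by move=> x y; rewrite /Tr; apply: (raddfD (galTrace 1%VS {: pPrimeCharType charFp})). Qed.

Lemma TrZ (h : 'F_p) (x : F) : Tr charFp ((h : nat)%:R * x) = (h : nat)%:R * Tr charFp x.
Proof. by rewrite !mulr_natl; apply: (raddfMn (galTrace 1%VS {: pPrimeCharType charFp})). Qed.

(** The Frobenius map generates the Galois group over the prime field, and the trace is invariant
    under that group. *)
Lemma Tr_Frobenius (x : F) : Tr charFp (x ^+ p) = Tr charFp x.
Proof.
have sKE : (1%AS <= {: pPrimeCharType charFp})%VS by exact: sub1v.
have [al gal_al al_x] := finField_galois_generator sKE.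
have p_pr := pcharf_prime charFp.
rewrite /Tr -[RHS](@galTrace_gal _ _ 1%AS {: pPrimeCharType charFp}%AS _ al) ?memvf //.
  by rewrite al_x ?memvf // dimv1 expn1 card_Fp.
by move: gal_al => /eqP->; rewrite cycle_id.
Qed.

(** By Dedekind independence, the sum of the automorphisms, with all coefficients equal to 1, is not
    the zero map. *)
Lemma Tr_neq0 : exists x, Tr charFp x != 0.
Proof.
have [a _] := @gal_independent_contra _ _ {: pPrimeCharType charFp}%AS [in 'Gal({: pPrimeCharType
  charFp} / 1)%g] (fun=> 1) _ (group1 _) (oner_neq0 _).
under eq_bigr do rewrite mul1r.
by exists a.
Qed.

Lemma Tr_prime_subfield (x : F) : exists h : 'F_p, Tr charFp x = (h : nat)%:R.
Proof.
have gal : galois 1%AS {: pPrimeCharType charFp}%AS by apply/finField_galois/sub1v.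
have /vlineP[h xh] := mem_galTrace gal (memvf (x : pPrimeCharType charFp)).
by exists h; rewrite /Tr [LHS]xh Fp_scale_natr mulr1.
Qed.

(** Replaces [Tr], whose values lie in [F], by a trace with values in ['F_p] and an embedding
    [iota]; the counting arguments work with this pair. *)
Lemma prime_field_trace :
  exists (iota : {rmorphism 'F_p -> F}) (tr : F -> 'F_p),
    [/\ forall h, iota h = (h : nat)%:R, forall x, iota (tr x) = Tr charFp x,
        {morph tr : x y / x + y}, forall h x, tr (iota h * x) = h * tr x
      & (forall x, tr (x ^+ p) = tr x) /\ exists x, tr x != 0].
Proof.
pose iota : {rmorphism 'F_p -> F} :=
  (in_alg (pPrimeCharType charFp) : {rmorphism 'F_p -> pPrimeCharType charFp}).
have iotaE h : iota h = (h : nat)%:R by rewrite /iota /= Fp_scale_natr mulr1.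
(* The default 0 is never reached, as [Tr] takes its values in the prime subfield. *)
pose tr x := odflt 0 [pick h | iota h == Tr charFp x].
have trE x : iota (tr x) = Tr charFp x.
  rewrite /tr; case: pickP => [h /eqP //|noh].
  by have [h hx] := Tr_prime_subfield x; move: (noh h); rewrite iotaE hx eqxx.
have iI : injective iota by exact: fmorph_inj.
exists iota, tr; split=> //.
- by move=> x y; apply: iI; rewrite rmorphD !trE TrD.
- by move=> h x; apply: iI; rewrite rmorphM !trE iotaE TrZ.
split=> [x|]; first by apply: iI; rewrite !trE Tr_Frobenius.
have [x nzx] := Tr_neq0; exists x.
by apply: contraNneq nzx => tr0; rewrite -trE tr0 rmorph0.
Qed.

End PrimeFieldTrace.

(** * Level sets of quadratic forms over a prime field *)

Lemma card_fibers (T T' : finType) (D : {set T}) (f : T -> T') :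
  #|D| = (\sum_t #|[set x in D | f x == t]|)%N.
Proof.
rewrite -sum1_card (partition_big f xpredT) //=.
by apply: eq_bigr => t _; rewrite -sum1_card; apply: eq_bigl => x; rewrite inE.
Qed.

Lemma card_fibersT (T T' : finType) (f : T -> T') :
  #|T| = (\sum_t #|[set x | f x == t]|)%N.
Proof.
rewrite -cardsT (card_fibers _ f); apply: eq_bigr => t _.
by apply: eq_card => x; rewrite !inE.
Qed.

Lemma card_shift (V : finZmodType) (P : pred V) (c : V) :
  #|[set x | P (x + c)]| = #|[set x | P x]|.
Proof.
rewrite -[RHS](card_preimset (f := +%R^~ c)); last exact: addIr.
by apply: eq_card => x; rewrite !inE.
Qed.

(** Translation by [r] injects the fibre over u into the fibre over u + s. Since s generates the
    additive group of F_p, all p fibres have the same size. *)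
Lemma equidistributed (p : nat) (V : finZmodType) (D : {set V}) (f : V -> 'F_p) (r : V) (s : 'F_p) :
    prime p -> s != 0 -> (forall x, x \in D -> x + r \in D) ->
    (forall x, x \in D -> f (x + r) = f x + s) ->
  forall t : 'F_p, (#|[set x in D | f x == t]| * p = #|D|)%N.
Proof.
move=> p_pr s0 Dr fr t.
have step (u : 'F_p) : (#|[set x in D | f x == u]| <= #|[set x in D | f x == (u + s)%R]|)%N.
  rewrite -(card_imset _ (addIr r)); apply: subset_leq_card.
  apply/subsetP=> _ /imsetP[x /setIdP[xD /eqP fx] ->].
  by rewrite inE Dr //= fr // fx.
have steps (u : 'F_p) n : (#|[set x in D | f x == u]| <= #|[set x in D | f x == (u + s *+ n)%R]|)%N.
  elim: n => [|n IH]; first by rewrite addr0.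
  by apply: leq_trans IH _; rewrite mulrSr addrA step.
have le (u v : 'F_p) : (#|[set x in D | f x == u]| <= #|[set x in D | f x == v]|)%N.
  have -> : v = u + s *+ (((v - u) / s : 'F_p) : nat).
    by rewrite -mulr_natr natr_Zp mulrC divfK // addrC subrK.
  exact: steps.
rewrite (card_fibers D f) (eq_bigr (fun=> #|[set x in D | f x == t]|)).
  by rewrite sum_nat_const card_Fp // mulnC.
by move=> u _; apply/eqP; rewrite eqn_leq !le.
Qed.

Lemma equidistributedT (p : nat) (V : finZmodType) (f : V -> 'F_p) (r : V) (s : 'F_p) :
    prime p -> s != 0 -> (forall x, f (x + r) = f x + s) ->
  forall t : 'F_p, (#|[set x | f x == t]| * p = #|V|)%N.
Proof.
move=> p_pr s0 fr t; have <- : #|[set x in [set: V] | f x == t]| = #|[set x | f x == t]|.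
  by apply: eq_card => x; rewrite !inE.
by rewrite -cardsT; apply: (equidistributed p_pr s0 (r := r)) => x _; rewrite ?inE.
Qed.

Section Quadratic.

Variables (p : nat) (F : finFieldType) (iota : {rmorphism 'F_p -> F}) (tr : F -> 'F_p).
Hypotheses (p_pr : prime p) (trD : {morph tr : x y / x + y}).
Hypotheses (trZ : forall h x, tr (iota h * x) = h * tr x) (tr_nz : exists x, tr x != 0).

Let q := #|F|.

Lemma tr0 : tr 0 = 0.
Proof. by rewrite -[0 in LHS](mul0r 0) -(rmorph0 iota) trZ mul0r. Qed.

Lemma trN x : tr (- x) = - tr x.
Proof. by rewrite -mulN1r -(rmorphN1 iota) trZ mulN1r. Qed.

Lemma trB x y : tr (x - y) = tr x - tr y.
Proof. by rewrite trD trN. Qed.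

Lemma card_tr_affine (c : F) (s t : 'F_p) :
  c != 0 -> (#|[set x | (s + tr (c * x))%R == t]| * p = q)%N.
Proof.
move=> c0; have [x0 nz] := tr_nz.
apply: (equidistributedT (r := x0 / c) p_pr nz) => x.
by rewrite mulrDr [c * (x0 / c)]mulrC divfK // trD addrA.
Qed.

Section Form.

(** The map [phi] represents the polar form of [Q] through the trace pairing. Given [QD], the
    hypothesis [Q2] amounts to Q(2x) = 4 Q(x). *)
Variables (Q : F -> 'F_p) (phi : F -> F).
Hypotheses (QD : forall x u, Q (x + u) = Q x + Q u + tr (phi u * x)).
Hypotheses (phiD : {morph phi : x y / x + y}) (Q2 : forall x, Q x + Q x = tr (phi x * x)).
Hypothesis p_odd : odd p.

Definition radical : {set F} := [set u | phi u == 0].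
Definition level (t : 'F_p) : nat := #|[set x | Q x == t]|.
Definition zeros (b : F) (h : 'F_p) : nat := #|[set x | Q x + tr (b * x) + h == 0]|.
Definition polar_image : {set F} := [set phi c | c in F].

Local Notation R := radical.

Lemma polar0 : phi 0 = 0.
Proof. by apply: (addrI (phi 0)); rewrite -phiD !addr0. Qed.

Lemma polarN x : phi (- x) = - phi x.
Proof. by apply/eqP; rewrite -addr_eq0 -phiD addNr polar0. Qed.

Lemma polar_sym x y : tr (phi x * y) = tr (phi y * x).
Proof. by have := QD y x; rewrite [y + x]addrC QD [Q y + Q x]addrC => /addrI. Qed.

Lemma form_radical u : u \in R -> Q u = 0.
Proof.
rewrite inE => /eqP u0; have := Q2 u; rewrite u0 mul0r tr0 -mulr2n -mulr_natr => /eqP.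
rewrite mulf_eq0 => /orP[/eqP //|]; rewrite -(dvdn_pcharf (pchar_Fp p_pr)).
move/(dvdn_leq (isT : 0 < 2)%N) => p2.
have /eqP p_eq2 : p == 2%N by rewrite eqn_leq p2 prime_gt1.
by have : odd 2 by rewrite -p_eq2.
Qed.

Lemma sum_level : (\sum_t level t = q)%N.
Proof. by rewrite /level -card_fibersT. Qed.

(** The sum of squares counts the pairs (x, x + u) with equal values of [Q], that is, with Q(u) +
    tr(phi(u) x) = 0. All q choices of x qualify for u in the radical, and q / p of them otherwise.
    The terms are arranged to avoid subtraction and division. *)
Lemma level_second_moment :
  ((\sum_t level t ^ 2) * p + #|R| * q = q ^ 2 + p * q * #|R|)%N.
Proof.
have pair_count : (\sum_t level t ^ 2 = \sum_u #|[set x | (Q u + tr (phi u * x))%R == 0%R]|)%N.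
  transitivity (\sum_x level (Q x))%N.
    rewrite [RHS](partition_big Q xpredT) //=; apply: eq_bigr => t _.
    rewrite (eq_bigr (fun=> level t)) => [|x /eqP-> //].
    rewrite sum_nat_const -mulnn; congr (_ * _)%N.
    by apply: eq_card => x; rewrite inE.
  transitivity (\sum_x \sum_(u | (Q u + tr (phi u * x))%R == 0%R) 1)%N.
    apply: eq_bigr => x _; rewrite sum1_card /level -(card_shift _ x).
    apply: eq_card => u; rewrite !inE addrC QD -addrA -subr_eq0 addrAC subrr add0r.
    by rewrite unfold_in.
  rewrite (exchange_big_dep xpredT) //=; apply: eq_bigr => u _.
  by rewrite sum1_card; apply: eq_card => x; rewrite inE unfold_in.
rewrite pair_count big_distrl /= (bigID (mem R)) /=.
rewrite (eq_bigr (fun=> q * p)%N); last first.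
  move=> u uR; congr (_ * _)%N; rewrite /q -cardsT; apply: eq_card => x.
  by rewrite !inE form_radical //; move: uR; rewrite inE => /eqP->; rewrite mul0r tr0 addr0 eqxx.
rewrite [X in (_ + X + _)%N](eq_bigr (fun=> q)); last first.
  by move=> u; rewrite inE => u0; apply: card_tr_affine.
rewrite !sum_nat_const.
have -> : #|[predC R]| = (q - #|R|)%N by rewrite /q -(cardC (mem R)) addKn; apply: eq_card.
have leR : (#|R| <= q)%N by apply: max_card.
rewrite mulnBl -mulnn -addnA subnK ?leq_mul // addnC.
by congr addn; rewrite [RHS]mulnC [(p * q)%N]mulnC.
Qed.

Definition radical_perp : {set F} := [set b | [forall r in R, tr (b * r) == 0]].

(** Counts in two ways the pairs (b, r) with r in the radical and tr(b r) = 0: a nonzero r has q / p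
    partners, while b has all of the radical or a p-th of it. *)
Lemma card_radical_perp : (#|radical_perp| * #|R| = q)%N.
Proof.
pose S := (\sum_(r in R) \sum_(b | tr (b * r)%R == 0%R) 1)%N.
have R0 : 0 \in R by rewrite inE polar0.
have S1 : (S * p + q = p * q + #|R| * q)%N.
  rewrite /S (bigD1 0) //= mulnDl sum1_card (eq_card (B := F)) => [|b]; last first.
    by rewrite unfold_in mulr0 tr0.
  rewrite big_distrl /= (eq_bigr (fun=> q)) => [|r /andP[_ r0]]; last first.
    rewrite -(card_tr_affine 0 0 r0) sum1_card; congr (_ * _)%N; apply: eq_card => b.
    by rewrite inE unfold_in add0r mulrC.
  have -> : #|R| = (1 + #|[pred r in R | r != 0%R]|)%N.
    rewrite (cardD1 0) R0; congr addn; apply: eq_card => r.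
    by rewrite !inE andbC.
  by rewrite sum_nat_const -addnA mulnDl mul1n [(q + _)%N]addnC mulnC.
have S2 : (S * p + #|radical_perp| * #|R| = q * #|R| + #|radical_perp| * #|R| * p)%N.
  rewrite /S (exchange_big_dep xpredT) //= big_distrl /= (bigID (mem radical_perp)) /=.
  rewrite (eq_bigr (fun=> #|R| * p)%N); last first.
    move=> b; rewrite inE => /'forall_implyP bR; congr (_ * _)%N; rewrite sum1_card.
    by apply: eq_card => r; rewrite unfold_in; case rR: (r \in R); rewrite //= bR.
  rewrite [X in (_ + X + _)%N](eq_bigr (fun=> #|R|)); last first.
    move=> b; rewrite inE negb_forall => /existsP[r0]; rewrite negb_imply => /andP[r0R nz].
    rewrite -(@equidistributed p F R (fun r => tr (b * r)) r0 _ p_pr nz _ _ 0).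
    - by congr (_ * _)%N; rewrite sum1_card; apply: eq_card => r; rewrite inE unfold_in.
    - by move=> x; move: r0R; rewrite !inE phiD => /eqP-> /eqP->; rewrite addr0.
    - by move=> x _; rewrite mulrDr trD.
  rewrite !sum_nat_const.
  have -> : #|[predC radical_perp]| = (q - #|radical_perp|)%N by rewrite /q -(cardC (mem
    radical_perp)) addKn; apply: eq_card.
  have leR : (#|radical_perp| <= q)%N by apply: max_card.
  by rewrite mulnBl -addnA subnK ?leq_mul // addnC mulnA.
have p1 := prime_gt1 p_pr.
have : ((p - 1) * (#|radical_perp| * #|R|) = (p - 1) * q)%N by rewrite !mulnBl; nia.
by move/eqP; rewrite eqn_pmul2l ?subn_gt0 // => /eqP.
Qed.

Lemma card_polar_image : (#|polar_image| * #|R| = q)%N.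
Proof.
rewrite /q (card_fibersT phi) (bigID (mem polar_image)) /=.
rewrite [X in (_ = _ + X)%N]big1 ?addn0 => [|b bP]; last first.
  apply/eqP; rewrite cards_eq0; apply/set0Pn => -[x]; rewrite inE => /eqP xb.
  by case/imsetP: bP; exists x.
rewrite (eq_bigr (fun=> #|R|)) ?sum_nat_const // => _ /imsetP[c _ ->].
rewrite -[RHS](card_shift _ (- c)); apply: eq_card => x.
by rewrite !inE phiD polarN subr_eq0.
Qed.

(** Symmetry of the polar form makes its image orthogonal to the radical, and the two sets have the
    same size. *)
Lemma polar_imageE : polar_image = radical_perp.
Proof.
have R0 : (0 < #|R|)%N by apply/card_gt0P; exists 0; rewrite inE polar0.
apply/eqP; rewrite eqEcard; apply/andP; split; last first.
  by rewrite -(leq_pmul2r R0) card_radical_perp card_polar_image.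
apply/subsetP=> _ /imsetP[c _ ->]; rewrite inE; apply/'forall_implyP => r.
by rewrite inE => /eqP r0; rewrite polar_sym r0 mul0r tr0.
Qed.

(** Completing the square: Q(x) + tr(phi(c) x) + h = Q(x + c) - (Q(c) - h). *)
Lemma zeros_polar c h : zeros (phi c) h = level (Q c - h).
Proof.
rewrite /level -(card_shift _ c); apply: eq_card => x; rewrite !inE QD.
by rewrite -[in RHS]subr_eq0; congr (_ == _); ring.
Qed.

(** Such a b fails to be orthogonal to some r in the radical; translation by r leaves [Q] unchanged
    and adds the nonzero constant tr(b r). *)
Lemma zeros_notin b h : b \notin polar_image -> (zeros b h * p = q)%N.
Proof.
rewrite polar_imageE inE negb_forall => /existsP[r]; rewrite negb_imply => /andP[rR nz].
have f x : Q (x + r) + tr (b * (x + r)) + h = (Q x + tr (b * x) + h) + tr (b * r).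
  rewrite QD (form_radical rR); move: rR; rewrite inE => /eqP->.
  by rewrite mul0r tr0 mulrDr trD; ring.
exact: (equidistributedT p_pr nz f).
Qed.

(** For b = phi(c), the map h |-> Q(c) - h permutes F_p, so all level sets occur once; for any other
    b, each of the p values of h gives q / p zeros. *)
Lemma card_zeros_pred (P : pred nat) :
  #|[set bh | P (zeros bh.1 bh.2)]| =
   (#|polar_image| * #|[set t | P (level t)]| + (q - #|polar_image|) * (p * P (q %/ p)))%N.
Proof.
transitivity (\sum_b #|[set h | P (zeros b h)]|)%N.
  rewrite (card_fibers _ fst); apply: eq_bigr => b _.
  have inj_pair : injective (@pair F 'F_p b) by move=> x y [].
  rewrite -[RHS](card_imset _ inj_pair); apply: eq_card => -[b' h] /=.
  rewrite !inE /=; apply/andP/imsetP => [[zv /eqP bb']|[h' + [-> ->]]].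
    by exists h; rewrite ?inE -bb'.
  by rewrite inE eqxx => ->.
rewrite (bigID (mem polar_image)) /=; congr (_ + _)%N.
  rewrite (eq_bigr (fun=> #|[set t | P (level t)]|)) ?sum_nat_const // => _ /imsetP[c _ ->].
  rewrite -[RHS](card_preimset (f := fun h => Q c - h)); last exact: subrI.
  by apply: eq_card => h; rewrite !inE zeros_polar.
rewrite (eq_bigr (fun=> p * P (q %/ p))%N); last first.
  move=> b /zeros_notin zb.
  have E h : P (zeros b h) = P (q %/ p)%N by rewrite -(zb h) mulnK ?prime_gt0.
  case: (P (q %/ p)%N) E => E.
    by rewrite muln1 -[RHS](card_Fp p_pr) -cardsT; apply: eq_card => h; rewrite !inE E.
  by rewrite muln0; apply/eqP; rewrite cards_eq0; apply/set0Pn => -[h]; rewrite inE E.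
rewrite sum_nat_const; congr (_ * _)%N.
by rewrite /q -(cardC (mem polar_image)) addKn; apply: eq_card.
Qed.

End Form.
End Quadratic.

(** * Designs from affine-invariant codes *)

Section AffineDesign.

Variables (F : finFieldType) (B : {set {set F}}) (k : nat).
Hypothesis B_size : forall X, X \in B -> #|X| = k.
Hypothesis B_affine :
  forall X (u v : F), X \in B -> u != 0 -> [set x | u * x + v \in X] \in B.

Let through (x y : F) := #|[set X in B | (x \in X) && (y \in X)]|.

Let through_le (x y x' y' : F) : x != y -> x' != y' -> (through x y <= through x' y')%N.
Proof.
move=> xy x'y'.
(* The map w |-> u w + v sends x' to x and y' to y, so the preimage of a block through x and y is a
   block through x' and y'. *)
pose u := (x - y) / (x' - y'); pose v := x - u * x'.
have u0 : u != 0 by rewrite mulf_neq0 ?invr_neq0 ?subr_eq0.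
have ux : u * x' + v = x by rewrite /v addrC subrK.
have uy : u * y' + v = y.
  have : u * (x' - y') = x - y by rewrite divfK // subr_eq0.
  by rewrite mulrBr /v => E; rewrite addrCA -opprB E opprB addrC subrK.
pose f (X : {set F}) := [set w | u * w + v \in X].
have f_inj : injective f.
  move=> X Y /setP XY; apply/setP=> w; have := XY ((w - v) / u); rewrite !inE.
  by rewrite mulrC divfK // subrK.
rewrite /through -(card_imset _ f_inj); apply/subset_leq_card/subsetP => _ /imsetP[X + ->].
by rewrite inE => /and3P[XB xX yX]; rewrite !inE ux uy xX yX B_affine.
Qed.

Lemma affine_2design :
  exists2 mu, is_2design [set: F] B #|F| k mu
            & (mu * (#|F| * #|F|.-1) = #|B| * (k * k.-1))%N.
Proof.
have thrE x y : x != y -> through x y = through 0 1.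
  by move=> xy; apply/eqP; rewrite eqn_leq !through_le // eq_sym oner_neq0.
exists (through 0 1).
  split=> [|X XB|S _ /eqP/cards2P-[x [y [xy ->]]]]; first by rewrite cardsT.
    by rewrite subsetT B_size.
  rewrite -(thrE x y xy); apply: eq_card => X; rewrite !inE; congr (_ && _).
  by rewrite subUset !sub1set.
(* Double counting of the triples (X, x, y) with x and y distinct points of the block X. *)
have pairs X : X \in B -> (\sum_(x | x \in X) \sum_(y | (y \in X) && (y != x)) 1 = k * k.-1)%N.
  move=> XB; rewrite -(B_size XB) -sum_nat_const; apply: eq_bigr => x xX.
  rewrite sum1_card [in RHS](cardsD1 x) xX /=; apply: eq_card => y.
  by rewrite !inE andbC.
rewrite -sum_nat_const -(eq_bigr _ pairs).
rewrite (exchange_big_dep xpredT) //=.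
rewrite mulnC -mulnA -sum_nat_const; apply: eq_big => // x _.
transitivity (\sum_(y | y != x) through 0%R 1%R)%N.
  rewrite sum_nat_const; congr (_ * _)%N.
  by rewrite -(cardC1 x); apply: eq_card => y; rewrite !inE.
rewrite [RHS](exchange_big_dep (fun y => y != x)) => [|X y _ /andP[] //] /=.
apply: eq_bigr => y yx; have xy : x != y by rewrite eq_sym.
rewrite -(thrE x y xy) sum1_card; apply: eq_card => X.
by rewrite inE [RHS]unfold_in /= yx andbT andbA.
Qed.

End AffineDesign.

(** * Words of equal weight and equal support *)

Section ProportionalSupports.

(** Words are handled through their parameters in [W]: [w0] stands for the zero word and
    [comb h t t'] for t - h t'. *)
Variables (p : nat) (T W : finType) (w0 : W) (ev : W -> T -> 'F_p).
Variables (scale : 'F_p -> W -> W) (comb : 'F_p -> W -> W -> W).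
Hypothesis p_pr : prime p.
Hypothesis ev_scale : forall h t x, ev (scale h t) x = h * ev t x.
Hypothesis ev_comb : forall h t t' x, ev (comb h t t') x = ev t x - h * ev t' x.
Hypothesis comb_eq : forall h t t', comb h t t' = w0 -> t = scale h t'.

Definition word_supp (t : W) : {set T} := [set x | ev t x != 0].

Variable i : nat.
Hypothesis i_gt0 : (0 < i)%N.
(** The bound i (p - 2) / (p - 1) is the largest possible average weight of the words t - h t', h
    nonzero, when t and t' have weight i and the same support. *)
Hypothesis gap : forall t, t != w0 -> (i * (p - 2) < #|word_supp t| * (p - 1))%N.

Local Notation words := [set t | #|word_supp t| == i].

(* Otherwise the p - 1 words t - h t', h <> 0, are nonzero; within the common support they vanish on
   sets that partition it, so their weights add up to at most i(p-2). *)
Lemma same_supp_scale t t' : t \in words -> word_supp t = word_supp t' ->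
  exists2 h, h != 0 & t = scale h t'.
Proof.
rewrite inE => /eqP ti tt'.
have [/existsP[h /andP[h0 /eqP/comb_eq E]]|] := boolP [exists h, (h != 0) && (comb h t t' == w0)].
  by exists h.
rewrite negb_exists => /forallP nz; exfalso.
have p1 := prime_gt1 p_pr.
have {}nz h : h != 0 -> comb h t t' != w0 by move=> h0; have := nz h; rewrite h0.
pose S := word_supp t; pose r x := ev t x / ev t' x.
have t'S x : x \in S -> ev t' x != 0 by rewrite /S tt' inE.
have wt_le h : h != 0 -> (#|word_supp (comb h t t')| + #|[set x in S | r x == h]| <= i)%N.
  move=> h0; rewrite -ti -/S -cardsUI [X in (_ + X)%N]eq_card0 ?addn0; last first.
    move=> x; rewrite !inE; apply/negP => /and3P[+ xS /eqP rx].
    by rewrite ev_comb -rx divfK ?subrr ?eqxx // t'S // inE.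
  apply/subset_leq_card/subsetP => x; rewrite !inE ev_comb => /orP[|/andP[] //].
  apply: contraNneq => tx0; have : x \notin word_supp t' by rewrite -tt' inE tx0 eqxx.
  by rewrite inE negbK tx0 => /eqP->; rewrite mulr0 subrr.
have cardNZ : #|[pred h : 'F_p | h != 0]| = (p - 1)%N.
  by rewrite -[in RHS](card_Fp p_pr) subn1 -(cardC1 (0 : 'F_p)); apply: eq_card => x; rewrite !inE.
have sumS : (\sum_(h : 'F_p | h != 0%R) #|[set x in S | r x == h]| = i)%N.
  rewrite -ti -/S [RHS](card_fibers S r) [RHS](bigD1 0) //= [X in (_ = X + _)%N]eq_card0 // => x.
  rewrite inE; apply/negP => /andP[xS]; rewrite mulf_eq0 invr_eq0 (negPf (t'S _ xS)) orbF.
  by move: xS; rewrite inE => /negPf->.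
have le_sum : (\sum_(h : 'F_p | h != 0%R) #|word_supp (comb h t t')| + i <= (p - 1) * i)%N.
  rewrite -[X in (_ + X)%N]sumS -big_split /= -cardNZ -sum_nat_const.
  by apply: leq_sum => h; apply: wt_le.
have lt_sum : ((p - 1) * (i * (p - 2)).+1 <= (\sum_(h : 'F_p | h != 0%R) #|word_supp (comb h t
  t')|) * (p - 1))%N.
  rewrite big_distrl /= -[X in (X * _.+1)%N]cardNZ -sum_nat_const.
  by apply: leq_sum => h h0; apply: gap; apply: nz.
move: le_sum lt_sum; set s := (\sum_(_ | _) _)%N => le_sum lt_sum.
have : ((p - 1) * (i * (p - 2)).+1 <= (p - 1) * (i * (p - 2)))%N.
  apply: leq_trans lt_sum _; rewrite mulnC leq_pmul2l ?subn_gt0 //.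
  by rewrite -(leq_add2r i); apply: leq_trans le_sum _; rewrite -mulnSr mulnC leq_mul //; lia.
by rewrite leq_pmul2l ?subn_gt0 // ltnn.
Qed.

(** The words with a given support are the p - 1 nonzero multiples of one of them, told apart by
    their value at a point of the support. *)
Lemma card_supports : #|words| = (#|word_supp @: words| * (p - 1))%N.
Proof.
rewrite (card_fibers words word_supp) (bigID (mem (word_supp @: words))) /=.
rewrite [X in (_ + X)%N]big1 ?addn0 => [|X XB]; last first.
  apply/eqP; rewrite cards_eq0; apply/set0Pn => -[t]; rewrite inE => /andP[tw /eqP tX].
  by case/negP: XB; rewrite -tX imset_f.
rewrite (eq_bigr (fun=> p - 1)%N) ?sum_nat_const // => _ /imsetP[t0 t0w ->].
have /card_gt0P[x0] : (0 < #|word_supp t0|)%N by move: t0w; rewrite inE => /eqP->.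
rewrite inE => x00.
have sc_inj : injective (scale^~ t0).
  by move=> h h' E; apply: (mulIf x00); rewrite -!ev_scale E.
have -> : (p - 1 = #|scale^~ t0 @: [set h : 'F_p | h != 0%R]|)%N.
  by rewrite card_imset // -[in LHS](card_Fp p_pr) subn1 -(cardC1 (0 : 'F_p));
    apply: eq_card => x; rewrite !inE.
apply: eq_card => t; apply/idP/imsetP => [|[h]].
  by rewrite inE => /andP[tw /eqP /(same_supp_scale tw)[h h0 ->]]; exists h; rewrite ?inE.
rewrite inE => h0 ->.
have E : word_supp (scale h t0) = word_supp t0.
  by apply/setP=> x; rewrite !inE ev_scale mulf_eq0 negb_or h0.
by rewrite !inE E eqxx andbT; move: t0w; rewrite inE.
Qed.

End ProportionalSupports.

(** * The forms [tr (a x^(p^l+1))] *)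

Section TwoToOne.

Variables (K : finFieldType) (g : K) (k : nat).
Hypotheses (k_gt0 : (0 < k)%N) (g_nz : g != 0) (gP : forall z : K, z ^+ k != g).
Hypothesis kerP : forall z : K, z ^+ k = 1 -> z = 1 \/ z = -1.

Local Notation fib y := (#|[set x : K | (x ^+ k)%R == y]| + #|[set x : K | (g * x ^+ k)%R == y]|)%N.

Let fiber_le2 (y : K) : y != 0 -> (#|[set x : K | (x ^+ k)%R == y]| <= 2)%N.
Proof.
move=> y0; case: (set_0Vmem [set x : K | x ^+ k == y]) => [->|[x0]]; first by rewrite cards0.
rewrite inE => /eqP x0y.
have x0nz : x0 != 0 by apply: contraNneq y0 => x0z; rewrite -x0y x0z expr0n eqn0Ngt k_gt0.
apply: leq_trans (_ : (#|[set x0; (- x0)%R]| <= 2)%N); last by rewrite cards2; case: (_ != _).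
apply/subset_leq_card/subsetP => x; rewrite !inE => /eqP xy.
have /kerP[e|e] : (x / x0) ^+ k = 1 by rewrite expr_div_n xy x0y divff.
  by rewrite -(divfK x0nz x) e mul1r eqxx.
by rewrite -(divfK x0nz x) e mulN1r eqxx orbT.
Qed.

Let fib_le2 (y : K) : (fib y <= 2)%N.
Proof.
have [->|y0] := eqVneq y 0.
  have E (c : K) : c != 0 -> [set x : K | c * x ^+ k == 0] = [set 0].
    by move=> c0; apply/setP=> x; rewrite !inE mulf_eq0 (negPf c0) expf_eq0 k_gt0.
  have E1 : [set x : K | x ^+ k == 0] = [set 0].
    by rewrite -(E 1) ?oner_neq0 //; apply/setP=> x; rewrite !inE mul1r.
  by rewrite E1 E // !cards1.
have E : [set x : K | g * x ^+ k == y] = [set x | x ^+ k == y / g].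
  by apply/setP=> x; rewrite !inE -[RHS](inj_eq (mulfI g_nz)) mulrCA mulfV // mulr1.
have yg0 : y / g != 0 by rewrite mulf_neq0 ?invr_neq0.
have [S0|[x1 x1S]] := set_0Vmem [set x : K | x ^+ k == y].
  by rewrite S0 cards0 E fiber_le2.
have [->|[x2]] := set_0Vmem [set x : K | g * x ^+ k == y].
  by rewrite cards0 addn0 fiber_le2.
move: x1S; rewrite !inE => /eqP x1y /eqP x2y.
have x2nz : x2 ^+ k != 0 by apply: contraNneq y0 => x2z; rewrite -x2y x2z mulr0.
by have := gP (x1 / x2); rewrite expr_div_n x1y -x2y mulfK // eqxx.
Qed.

(** No y is reached more than twice: the power map has kernel within 1 and -1, and a nonzero y
    cannot be both x1^k and g x2^k, since g is no k-th power. The fibres total 2 |K|, so equality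
    holds everywhere. This serves for [F] with k = p^l + 1 and for F_p with k = 2. *)
Lemma two_to_one (y : K) : fib y = 2.
Proof.
have sum_fib : (\sum_z fib z = \sum_(z : K) 2)%N.
  rewrite sum_nat_const big_split /= -!card_fibersT muln2 addnn.
  by congr double; apply: eq_card.
have le_sum : (\sum_(z | z != y) fib z <= \sum_(z : K | z != y) 2)%N.
  exact: leq_sum.
move: sum_fib; rewrite (bigD1 y) //= [RHS](bigD1 y) //= => sum_fib.
apply/eqP; rewrite eqn_leq fib_le2 -(leq_add2r (\sum_(z : K | z != y) 2)) -sum_fib.
by rewrite leq_add2l.
Qed.

End TwoToOne.

(** Squaring identifies 1 and -1, so it is not injective, hence not surjective, on F_p. *)
Lemma Fp_nonsquare p : prime p -> odd p -> exists g : 'F_p, forall z, z ^+ 2 != g.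
Proof.
move=> p_pr p_odd; have [/existsP[g /forallP gP]|] := boolP [exists g : 'F_p, [forall z, z ^+ 2
  != g]].
  by exists g.
rewrite negb_exists => /forallP surj.
have : #|(fun x : 'F_p => x ^+ 2) @: [set: 'F_p]| = #|[set: 'F_p]|.
  apply: eq_card => x; rewrite inE; apply/imsetP.
  by have := surj x; rewrite negb_forall => /existsP[z]; rewrite negbK => /eqP<-; exists z.
move/eqP/imset_injP => /(_ 1 (-1)); rewrite !inE sqrrN => /(_ isT isT erefl)/eqP.
rewrite -subr_eq0 opprK -(natrD _ 1 1) -(dvdn_pcharf (pchar_Fp p_pr)).
move/(dvdn_leq (isT : 0 < 2)%N) => p2.
have /eqP p_eq2 : p == 2%N by rewrite eqn_leq p2 prime_gt1.
by have : odd 2 by rewrite -p_eq2.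
Qed.

(** A family of rewriting rules that separates the five deviations 0, Y - X, -X, Y - Z and Y
    occurring, up to a common sign, for even m. *)
Lemma even_dev_neq (X Y Z : rat) : 0 < X -> 3 * X <= Y -> 3 * Y <= Z ->
  (((0 == Y - X) = false) * ((0 == - X) = false) * ((0 == Y - Z) = false) * ((0 == Y) = false)
   * ((Y - X == 0) = false) * ((Y - X == - X) = false) * ((Y - X == Y - Z) = false) * ((Y - X ==
     Y) = false)
   * ((- X == 0) = false) * ((- X == Y - X) = false) * ((- X == Y - Z) = false) * ((- X == Y) =
     false)
   * ((Y - Z == 0) = false) * ((Y - Z == Y - X) = false) * ((Y - Z == - X) = false) * ((Y - Z ==
     Y) = false)
   * ((Y == 0) = false) * ((Y == Y - X) = false) * ((Y == - X) = false) * ((Y == Y - Z) =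
     false))%type.
Proof. by move=> *; do !split; apply/eqP; lra. Qed.

(** * The form, its polar map, and the moments of its level sets *)

Section TraceForm.

Variables (p m l : nat) (F : finFieldType) (iota : {rmorphism 'F_p -> F}) (tr : F -> 'F_p).
Hypotheses (p_pr : prime p) (p_odd : odd p) (charFp : p \in [pchar F]).
Hypotheses (cardF : #|F| = (p ^ m)%N) (m_gt0 : (0 < m)%N) (ml_coprime : coprime m l).
Hypotheses (trD : {morph tr : x y / x + y}) (trZ : forall h x, tr (iota h * x) = h * tr x).
Hypotheses (trX : forall x, tr (x ^+ p) = tr x) (tr_nz : exists x, tr x != 0).

Lemma frobD n (x y : F) : (x + y) ^+ (p ^ n) = x ^+ (p ^ n) + y ^+ (p ^ n).
Proof. by rewrite exprDn_pchar // pnatX pnatE // charFp. Qed.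

Lemma frobN n (x : F) : (- x) ^+ (p ^ n) = - x ^+ (p ^ n).
Proof. by rewrite exprNn_pchar // pnatX pnatE // charFp. Qed.

Lemma tr_frob n (x : F) : tr (x ^+ (p ^ n)) = tr x.
Proof. by elim: n => [|n IH]; rewrite ?expr1 // expnSr exprM trX. Qed.

Lemma frob_iter n i (x : F) : x ^+ (p ^ n) = x -> x ^+ (p ^ (i * n)) = x.
Proof. by move=> xn; elim: i => [|i IH]; rewrite ?expr1 // mulSn expnD exprM xn. Qed.

Lemma frob_m i (x : F) : x ^+ (p ^ (i * m)) = x.
Proof. by apply: frob_iter; rewrite -cardF expf_card. Qed.

(** A Bezout relation ki i = kj j + gcd(i, j) between the exponents leaves only the Frobenius power
    of index gcd(i, j). *)
Lemma frob_gcd i j (x : F) :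
  (0 < i)%N -> x ^+ (p ^ i) = x -> x ^+ (p ^ j) = x -> x ^+ (p ^ gcdn i j) = x.
Proof.
move=> i0 xi xj; have [ki kj e _] := egcdnP j i0.
by have := frob_iter ki xi; rewrite e expnD exprM (frob_iter _ xj).
Qed.

Lemma frob_fixed_iota (x : F) : x ^+ p = x -> exists h, x = iota h.
Proof.
(* Over F_p, X^p - X is the product of the X - h; it is evaluated at x. *)
move=> xp; have := congr1 (fun P => (map_poly iota P).[x]) (finField_genPoly 'F_p).
rewrite rmorphB rmorph_prod /= map_polyXn map_polyX horner_prod !hornerE card_Fp // xp subrr.
move=> /esym/eqP/prodf_eq0[h _]; rewrite rmorphB /= map_polyX map_polyC !hornerE subr_eq0 => /eqP
  xh.
by exists h.
Qed.

Lemma iota_frob n h : iota h ^+ (p ^ n) = iota h.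
Proof.
elim: n => [|n IH]; rewrite ?expr1 // expnSr exprM IH -rmorphXn /=.
by congr (iota _); rewrite -[in X in _ ^+ X](card_Fp p_pr) expf_card.
Qed.

Local Notation s := (p ^ l)%N.
Local Notation k := (p ^ l + 1)%N.

Definition gold (a x : F) : 'F_p := tr (a * x ^+ k).
(* The exponent p^(l(m-1)) inverts x |-> x^(p^l). *)
Definition gold_polar (a u : F) : F := (a * u) ^+ (p ^ (l * m.-1)) + a * u ^+ s.

(** Raising the first term to the power p^l keeps its trace and turns (a u)^(p^(l(m-1))) into (a
    u)^(p^(lm)) = a u. *)
Lemma tr_gold_polar (a x u : F) : tr (gold_polar a u * x) = tr (a * u * x ^+ s) + tr (a * u ^+ s
  * x).
Proof.
rewrite mulrDl trD; congr (_ + _).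
rewrite -(tr_frob l) exprMn -exprM -expnD -mulnSr prednK //.
by rewrite frob_m.
Qed.

Lemma goldD a x u : gold a (x + u) = gold a x + gold a u + tr (gold_polar a u * x).
Proof.
rewrite tr_gold_polar -!trD /gold !addn1 !exprS frobD; congr tr; ring.
Qed.

Lemma gold2 a x : gold a x + gold a x = tr (gold_polar a x * x).
Proof. by rewrite tr_gold_polar /gold -!mulrA addn1 [x ^+ s * x]mulrC exprS. Qed.

Lemma gold_polarD a : {morph gold_polar a : x y / x + y}.
Proof. by move=> x y; rewrite /gold_polar !mulrDr !frobD mulrDr addrACA. Qed.

Lemma goldZ a (h : 'F_p) x : gold a (iota h * x) = h ^+ 2 * gold a x.
Proof.
by rewrite /gold exprMn addn1 exprS iota_frob -expr2 mulrCA -rmorphXn trZ.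
Qed.

(** The power p^l clears the inverse Frobenius map and leaves a linearized polynomial in u. *)
Lemma gold_polar_eq0 a u :
  (gold_polar a u == 0) = (a * u + a ^+ s * (u ^+ s) ^+ s == 0).
Proof.
have -> : a * u + a ^+ s * (u ^+ s) ^+ s = gold_polar a u ^+ s.
  rewrite /gold_polar frobD -[((a * u) ^+ _) ^+ s]exprM -expnD -mulnSr prednK // frob_m.
  by rewrite exprMn.
by rewrite expf_eq0 expn_gt0 prime_gt0.
Qed.

Lemma natr2_neq0 : 2%:R != 0 :> F.
Proof.
apply/negP; rewrite -(dvdn_pcharf charFp) => /(dvdn_leq (isT : 0 < 2)%N) p2.
have /eqP p_eq2 : p == 2%N by rewrite eqn_leq p2 prime_gt1.
by have : odd 2 by rewrite -p_eq2.
Qed.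

Local Notation glevel a := (level (gold a)).
Local Notation gradical a := (radical (gold_polar a)).

Lemma polar_zero a : gold_polar a 0 = 0.
Proof. by apply: (addrI (gold_polar a 0)); rewrite -gold_polarD !addr0. Qed.

Local Notation P := (p%:R : rat).

(** The mean of the p level sizes is q / p = p^(m-1). Rationals are used because the deviation has a
    sign. *)
Definition dev (a : F) (t : 'F_p) : rat := (glevel a t)%:R - P ^+ m.-1.

Lemma P_ge3 : 3 <= P.
Proof.
by rewrite (ler_nat _ 3) ltn_neqAle prime_gt1 // andbT; apply: contraTneq p_odd => <-.
Qed.

Lemma natr_predp : p.-1%:R = P - 1.
Proof. by rewrite -subn1 natrB ?prime_gt0. Qed.

Lemma expP_pred : P ^+ m = P * P ^+ m.-1.
Proof. by rewrite -exprS prednK. Qed.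

Lemma sum_dev a : \sum_t dev a t = 0.
Proof.
rewrite /dev sumrB -natr_sum sum_level cardF sumr_const card_Fp // natrX expP_pred.
by rewrite -[P ^+ m.-1 *+ p]mulr_natl subrr.
Qed.

(** The second moment, recentred at the mean. *)
Lemma sum_dev_sqr a : \sum_t dev a t ^+ 2 = P ^+ m.-1 * (P - 1) * #|gradical a|%:R.
Proof.
have := level_second_moment p_pr trD trZ tr_nz (goldD a) (gold2 a) p_odd.
move/(congr1 (fun n => n%:R : rat)); rewrite !(natrD, natrM, natrX) cardF natr_sum natrX.
rewrite expP_pred; set n := P ^+ m.-1 => E.
have P0 : P != 0 by rewrite pnatr_eq0 -lt0n prime_gt0.
apply: (mulfI P0); have -> : \sum_t dev a t ^+ 2 =
    \sum_t (glevel a t ^ 2)%:R - (2 * n) * (\sum_t dev a t) - \sum_(t : 'F_p) n ^+ 2.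
  rewrite mulr_sumr -!sumrB; apply: eq_bigr => t _; rewrite /dev natrX -/n; ring.
rewrite sum_dev sumr_const card_Fp // -[n ^+ 2 *+ p]mulr_natl.
by apply: (addrI (#|gradical a|%:R * (P * n))); rewrite mulr0 subr0 mulrBr addrA [_ + P * _]addrC
  [P * \sum__ _]mulrC E; ring.
Qed.

Lemma devZ a (h t : 'F_p) : h != 0 -> dev a (h ^+ 2 * t) = dev a t.
Proof.
move=> h0; have ih0 : iota h != 0 by rewrite fmorph_eq0.
congr (_%:R - _); rewrite /level -[LHS](card_preimset (f := *%R (iota h))); last exact: mulfI.
by apply: eq_card => x; rewrite !inE goldZ (inj_eq (mulfI _)) ?expf_neq0.
Qed.

(** * Level sets for odd m *)

Section OddDegree.

Hypothesis m_odd : odd m.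

(** For odd m, gcd(m, 2l) = 1, so the elements of [F] fixed by the power p^(2l) are those of F_p. *)
Lemma frob_fixed_odd (x : F) : (x ^+ s) ^+ s = x -> exists h, x = iota h.
Proof.
rewrite -exprM -expnD addnn -mul2n => xs; apply: frob_fixed_iota.
have := @frob_gcd m (2 * l) x m_gt0; rewrite -{1}[m]mul1n frob_m => /(_ erefl xs).
by rewrite (eqP (_ : coprime m (2 * l))) ?expn1 // coprimeMr coprimen2 m_odd.
Qed.

Lemma gold_radical_odd a : a != 0 -> gradical a = [set 0].
Proof.
move=> a0; apply/setP=> u; rewrite !inE; apply/idP/eqP => [|->]; last by rewrite polar_zero.
rewrite gold_polar_eq0 addrC addr_eq0 => /eqP us; apply/eqP/negPn/negP => u0.
(* The equation of the radical becomes w^(p^l) = -w. Hence the power p^(2l) fixes w, which then lies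
   in F_p, where w^(p^l) = w; so w = 0. *)
pose w := a * u ^+ k.
have ws : w ^+ s = - w.
  by rewrite /w exprMn addn1 exprS exprMn mulrCA us; ring.
have [h wh] : exists h, w = iota h by apply: frob_fixed_odd; rewrite ws frobN ws opprK.
have /eqP : w = - w by rewrite -ws wh iota_frob.
rewrite -addr_eq0 -mulr2n -mulr_natr mulf_eq0 (negPf natr2_neq0) orbF /w.
by rewrite mulf_eq0 (negPf a0) expf_eq0 (negPf u0) andbF.
Qed.

(* The sum counts the (u, x) in {1, g} x F with tr (a u x^(p^l+1)) = t, and (u, x) |-> u x^(p^l+1)
   is two-to-one onto F. *)
Lemma level_pair (a : F) (g t : 'F_p) : a != 0 -> (forall z, z ^+ 2 != g) ->
  ((glevel a t + glevel a (g^-1 * t)%R) * p = 2 * p ^ m)%N.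
Proof.
move=> a0 gP.
have g0 : g != 0 by have := gP 0; rewrite expr0n eq_sym.
have ig0 : iota g != 0 by rewrite fmorph_eq0.
have s1 (h : 'F_p) : iota h ^+ k = iota (h ^+ 2) by rewrite addn1 exprS iota_frob -expr2 rmorphXn.
(* If z^(p^l+1) = g, then z is fixed by the power p^(2l), so z lies in F_p and g = z^2. The equation
   z^k = 1 below is reduced to z^2 = 1 in the same way. *)
have kg z : z ^+ k != iota g.
  apply/negP=> /eqP zg.
  have z0 : z != 0 by apply: contraNneq ig0 => z0; rewrite -zg z0 addn1 expr0n.
  have zs : z ^+ s = iota g / z by rewrite -zg addn1 exprS mulrC mulKf.
  have [|h zh] := @frob_fixed_odd z.
    by rewrite zs exprMn exprVn zs iota_frob invfM invrK mulrA mulfV // mul1r.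
  by move: zg; rewrite zh s1 => /fmorph_inj/eqP; apply/negP.
have k1 (z : F) : z ^+ k = 1 -> z = 1 \/ z = -1.
  move=> z1.
  have z0 : z != 0 by apply/eqP=> z0; move/eqP: z1; rewrite z0 addn1 exprS mul0r eq_sym oner_eq0.
  have zs : z ^+ s = z^-1 by apply: (mulfI z0); rewrite -exprS -addn1 z1 mulfV.
  have [|h zh] := @frob_fixed_odd z; first by rewrite zs exprVn zs invrK.
  move: z1; rewrite zh s1 -(rmorph1 iota) => /fmorph_inj/eqP.
  by rewrite sqrf_eq1 => /orP[/eqP->|/eqP->]; [left|right]; rewrite ?rmorphN ?rmorph1.
have k0 : (0 < k)%N by rewrite addn1.
rewrite -cardF -(card_tr_affine p_pr trD tr_nz 0 t a0) mulnA; congr (_ * _)%N.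
have sumE (c : 'F_p) : c != 0 -> glevel a (c^-1 * t) =
    (\sum_(y | tr (a * y)%R == t) #|[set x : F | (iota c * x ^+ k)%R == y]|)%N.
  move=> c0; rewrite /level (card_fibers _ (fun x => iota c * x ^+ k)) (bigID (fun y => tr (a *
    y) == t)) /=.
  rewrite [X in (_ + X)%N]big1 ?addn0 => [|y ny]; last first.
    apply/eqP; rewrite cards_eq0; apply/set0Pn => -[x]; rewrite !inE => /andP[/eqP gx /eqP xy].
    by case/negP: ny; rewrite -xy mulrCA trZ -/(gold a x) gx mulVKf.
  apply: eq_bigr => y /eqP yt; apply: eq_card => x; rewrite !inE.
  apply: andb_idl => /eqP xy; rewrite -yt -xy mulrCA trZ mulKf //.
have -> : glevel a t = glevel a (1^-1 * t)%R by rewrite invr1 mul1r.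
rewrite !sumE ?oner_neq0 // -big_split /=.
rewrite (eq_bigr (fun=> 2)) ?sum_nat_const 1?mulnC => [|y _].
  by congr (_ * _)%N; apply: eq_card => y; rewrite inE unfold_in add0r.
rewrite -(two_to_one k0 ig0 kg k1 y); congr (_ + _)%N.
by apply: eq_card => x; rewrite !inE rmorph1 mul1r.
Qed.

(** Multiplying t by g^-1 negates the deviation, and multiplying it by a nonzero square preserves
    it. So the deviation vanishes at 0 and has constant absolute value elsewhere, each sign being
    taken equally often; the second moment with trivial radical gives that value. *)
Lemma gold_odd_spectrum a : a != 0 ->
  [/\ forall v : rat, v != 0 -> v != P ^+ m.-1./2 -> v != - P ^+ m.-1./2 ->
        #|[set t | dev a t == v]| = 0%N,
      #|[set t | dev a t == 0]| = 1%N,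
      (#|[set t | dev a t == P ^+ m.-1./2]| * 2 = p - 1)%N
    & (#|[set t | dev a t == - P ^+ m.-1./2]| * 2 = p - 1)%N].
Proof.
move=> a0; have [g gP] := Fp_nonsquare p_pr p_odd.
have g0 : g != 0 by have := gP 0; rewrite expr0n eq_sym.
have P3 := P_ge3.
have P0 : P != 0 by rewrite pnatr_eq0 -lt0n prime_gt0.
set j := m.-1./2.
have jE : P ^+ m.-1 = (P ^+ j) ^+ 2.
  rewrite -exprM muln2 -[in LHS](odd_double_half m.-1).
  by have : ~~ odd m.-1 by [rewrite -oddS prednK]; move/negPf->.
have Pj0 : 0 < P ^+ j by rewrite exprn_gt0 //; lra.
have devg t : dev a (g^-1 * t) = - dev a t.
  have /(congr1 (fun n => n%:R : rat)) := level_pair t a0 gP.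
  rewrite !(natrD, natrM, natrX) expP_pred => E; apply/eqP; rewrite -addr_eq0; apply/eqP.
  by apply: (mulIf P0); rewrite mul0r /dev; lra.
have dev0 : dev a 0 = 0 by have := devg 0; rewrite mulr0 => ?; lra.
have sq t : t != 0 -> dev a t ^+ 2 = dev a 1 ^+ 2.
  move=> t0; have k1 (z : 'F_p) : z ^+ 2 = 1 -> z = 1 \/ z = -1.
    by move/eqP; rewrite sqrf_eq1 => /orP[/eqP->|/eqP->]; [left|right].
  (* Every nonzero t is a square or g times a square. *)
  have := two_to_one (isT : 0 < 2)%N g0 gP k1 t.
  case: (set_0Vmem [set x : 'F_p | x ^+ 2 == t]) => [-> |[x]].
    rewrite cards0 add0n; case: (set_0Vmem [set x : 'F_p | g * x ^+ 2 == t]) => [-> |[x]].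
      by rewrite cards0.
    rewrite inE => /eqP xt _.
    have x0 : x != 0 by apply: contraNneq t0 => x0; rewrite -xt x0 expr0n mulr0.
    rewrite -[LHS]sqrrN -devg -xt mulKf // -[x ^+ 2]mulr1 devZ //.
  rewrite inE => /eqP xt _.
  have x0 : x != 0 by apply: contraNneq t0 => x0; rewrite -xt x0 expr0n.
  by rewrite -xt -[x ^+ 2]mulr1 devZ.
have sq1 : dev a 1 ^+ 2 = (P ^+ j) ^+ 2.
  have := sum_dev_sqr a; rewrite gold_radical_odd // cards1 mulr1 (bigD1 0) //= dev0 expr0n /=
    add0r.
  rewrite (eq_bigr (fun=> dev a 1 ^+ 2)) => [|t t0]; last exact: sq.
  rewrite sumr_const -jE; have -> : #|[pred t : 'F_p | t != 0]| = p.-1.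
    by rewrite -[in RHS](card_Fp p_pr) -(cardC1 (0 : 'F_p)); apply: eq_card => x; rewrite !inE.
  rewrite -[_ *+ _]mulr_natr; rewrite natr_predp.
  by apply: mulIf; apply/eqP; lra.
have dev_pm t : t != 0 -> (dev a t == P ^+ j) || (dev a t == - P ^+ j).
  by move=> t0; rewrite -eqf_sqr sq // sq1.
have pos_neg : #|[set t | dev a t == P ^+ j]| = #|[set t | dev a t == - P ^+ j]|.
  rewrite -[LHS](card_preimset (f := *%R g^-1)); last by apply: mulfI; rewrite invr_neq0.
  by apply: eq_card => t; rewrite !inE devg eqr_oppLR.
have tot : (#|[set t | dev a t == P ^+ j]| + #|[set t | dev a t == - P ^+ j]| = p - 1)%N.
  have I0 : [set t | dev a t == P ^+ j] :&: [set t | dev a t == - P ^+ j] = set0.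
    by apply/setP=> t; rewrite !inE; apply/negP=> /andP[/eqP-> /eqP]; lra.
  rewrite -cardsUI I0 cards0 addn0.
  rewrite -[in RHS](card_Fp p_pr) subn1 -(cardC1 (0 : 'F_p)); apply: eq_card => t; rewrite !inE.
  have [->|/dev_pm //] := eqVneq t 0; rewrite dev0; apply/negP => /orP[] /eqP; lra.
split; last 2 first.
- by rewrite muln2 -addnn -tot pos_neg.
- by rewrite muln2 -addnn -tot pos_neg.
- move=> v v0 vj vj'; apply/eqP; rewrite cards_eq0; apply/set0Pn => -[t].
  rewrite inE => /eqP tv; have [t0|/dev_pm] := eqVneq t 0.
    by case/eqP: v0; rewrite -tv t0 dev0.
  by rewrite tv (negPf vj) (negPf vj').
- rewrite -(cards1 (0 : 'F_p)); apply: eq_card => t; rewrite !inE.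
  have [->|/dev_pm] := eqVneq t 0; first by rewrite dev0 eqxx.
  by case/orP=> /eqP->; apply/eqP; lra.
Qed.

End OddDegree.

(** * Level sets for even m, and the number of degenerate forms *)

Section EvenDegree.

Hypothesis m_even : ~~ odd m.

Lemma m_halfE : m = (2 * m./2)%N.
Proof. by rewrite mul2n -[LHS]odd_double_half (negPf m_even). Qed.

Lemma m_half_gt0 : (0 < m./2)%N.
Proof. by rewrite -(ltn_pmul2l (isT : 0 < 2)%N) muln0 -m_halfE. Qed.

Lemma l_odd : odd l.
Proof. by move: ml_coprime; rewrite {1}m_halfE coprimeMl coprime2n => /andP[]. Qed.

Local Notation d := (p ^ 2).-1.

Lemma dE : d = (p.-1 * p.+1)%N.
Proof. by have := prime_gt0 p_pr; case: (p) => // n _; rewrite -subn1 -(exp1n 2) subn_sqr addn1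
  subn1. Qed.

(** As p^2 - 1 divides q - 1, such a root exists; its powers are the units of F_(p^2), and the
    subfield enters only through them. *)
Lemma quadratic_prim_root : exists z : F, d.-primitive_root z.
Proof.
have p1 := prime_gt1 p_pr.
have q1 : (0 < #|F|.-1)%N by rewrite -subn1 subn_gt0 finNzRing_gt1.
have /hasP[z _ zP] : has #|F|.-1.-primitive_root (enum (predC1 (0 : F))).
  apply: has_prim_root => //; last 2 first.
  - exact: enum_uniq.
  - by rewrite -cardE cardC1.
  apply/allP=> x; rewrite mem_enum inE => x0; apply/unity_rootP.
  by apply: (mulfI x0); rewrite -exprS prednK ?expf_card ?mulr1 // (ltn_trans _ (finNzRing_gt1 F)).
exists (z ^+ (#|F|.-1 %/ d)); apply: dvdn_prim_root => //.
by rewrite cardF m_halfE expnM (predn_exp (p ^ 2)) dvdn_mulr.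
Qed.

Section PrimRoot.

Variable z : F.
Hypothesis zP : d.-primitive_root z.

Lemma d_gt0 : (0 < d)%N.
Proof. exact: prim_order_gt0 zP. Qed.

Lemma zX_frob2 i : (z ^+ i) ^+ (p ^ 2) = z ^+ i.
Proof.
rewrite exprAC; congr (_ ^+ i).
by rewrite -[in LHS](prednK (_ : 0 < p ^ 2)%N) ?expn_gt0 ?prime_gt0 // exprS prim_expr_order //
  mulr1.
Qed.

(** As l is odd, the power p^l acts on F_(p^2) as the power p, so p^l + 1 gives the norm. *)
Lemma zX_gold i : (z ^+ i) ^+ k = (z ^+ i) ^+ p.+1.
Proof.
rewrite addn1 !exprS; congr (_ * _).
rewrite -[l]odd_double_half l_odd add1n expnSr exprM -muln2 mulnC.
by rewrite mulnC frob_iter // zX_frob2.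
Qed.

Lemma zX_norm i : exists h, (z ^+ i) ^+ p.+1 = iota h.
Proof.
have := zX_frob2 i; move: (z ^+ i) => y y2; apply: frob_fixed_iota.
by rewrite exprS exprMn -exprM mulnn y2 mulrC.
Qed.

(** The norm z^(p+1) of the generator has order p - 1, so it generates the units of F_p. *)
Lemma norm_surj (h : 'F_p) : h != 0 -> exists i, iota h = (z ^+ i) ^+ p.+1.
Proof.
move=> h0; have zp : p.-1.-primitive_root (z ^+ p.+1).
  have := exp_prim_root zP p.+1; rewrite dE (gcdn_idPl _) ?dvdn_mull // mulnK //.
have [|i ->] := prim_rootP zp (x := iota h); last by exists i; rewrite exprAC.
apply: (mulfI (_ : iota h != 0)); first by rewrite fmorph_eq0.
by rewrite -exprS prednK ?prime_gt0 // mulr1; apply: (iota_frob 1).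
Qed.

Lemma gold_zX a i h x : (z ^+ i) ^+ p.+1 = iota h -> gold a (z ^+ i * x) = h * gold a x.
Proof. by move=> zh; rewrite /gold exprMn zX_gold zh mulrCA trZ. Qed.

Lemma z_neq0 : z != 0.
Proof.
apply/eqP=> z0; have /eqP := prim_expr_order zP; rewrite z0 expr0n.
by rewrite eqn0Ngt d_gt0 eq_sym oner_eq0.
Qed.

Lemma dev_neq0 a t : t != 0 -> dev a t = dev a 1.
Proof.
move=> t0; have [i ti] := norm_surj t0; congr (_%:R - _).
have zi0 : z ^+ i != 0 by rewrite expf_neq0 ?z_neq0.
rewrite /level -[LHS](card_preimset (f := *%R (z ^+ i))); last exact: mulfI.
apply: eq_card => x; rewrite !inE (gold_zX _ _ (esym ti)).
by rewrite -[in LHS](mulr1 t) -mulrA mul1r (inj_eq (mulfI t0)).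
Qed.

Lemma card_zX (x0 : F) : x0 != 0 -> #|[set z ^+ (i : 'I_d) * x0 | i : 'I_d]| = d.
Proof.
move=> x00; rewrite card_imset ?card_ord // => i j /(mulIf x00)/eqP.
by rewrite (eq_prim_root_expr zP) !modn_small // => /eqP/val_inj.
Qed.

(* The group generated by z, the units of F_(p^2), acts freely on the nonzero zeros of the form. *)
Lemma level0_mod a : exists c, glevel a 0 = (1 + d * c)%N.
Proof.
pose S := [set x | gold a x == 0] :\ 0.
have -> : glevel a 0 = (1 + #|S|)%N.
  rewrite /level (cardsD1 0); congr (_ + _)%N.
  by rewrite inE /gold addn1 expr0n mulr0 (tr0 trZ) eqxx.
suff /dvdnP[c ->] : (d %| #|S|)%N by exists c; rewrite mulnC.
(* The nonempty fibres of x |-> x^(p^2-1) on the nonzero zeros are the orbits, of p^2 - 1 elements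
   each. *)
rewrite (card_fibers S (fun x => x ^+ d)); apply: dvdn_sum => v _.
case: (set_0Vmem [set x in S | x ^+ d == v]) => [->|[x0]]; first by rewrite cards0 dvdn0.
rewrite !inE => /andP[/andP[x00 /eqP gx0] /eqP x0v].
rewrite (_ : [set x in S | _] = [set z ^+ (i : 'I_d) * x0 | i : 'I_d]) ?card_zX //.
apply/setP=> x; rewrite !inE; apply/idP/imsetP => [/andP[/andP[x_nz _] /eqP xv]|[i _ ->]].
  have [|i xi] := prim_rootP zP (x := x / x0); last by exists i; rewrite // -xi divfK.
  by rewrite expr_div_n xv x0v divff // -x0v expf_neq0.
have [h zh] := zX_norm i.
rewrite mulf_neq0 ?expf_neq0 ?z_neq0 //= (gold_zX _ _ zh) gx0 mulr0 eqxx /=.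
by rewrite exprMn x0v [(z ^+ i) ^+ d]exprAC (prim_expr_order zP) expr1n mul1r.
Qed.

(** The ratio of two nonzero elements of the radical is fixed by the power p^(2l), hence by p^2,
    since gcd(m, 2l) = 2. So the radical is 0 or a line over F_(p^2). *)
Lemma card_gold_radical a : a != 0 -> exists r, (r <= 1)%N /\ #|gradical a| = (p ^ (2 * r))%N.
Proof.
move=> a0; have R0 : 0 \in gradical a by rewrite inE polar_zero.
case: (set_0Vmem (gradical a :\ 0)) => [E|[u0]].
  by exists 0%N; rewrite (cardsD1 0) R0 E cards0.
rewrite !inE gold_polar_eq0 addrC addr_eq0 => /andP[u00 /eqP Eu0].
exists 1%N; split=> //; rewrite (cardsD1 0) R0 muln1.
rewrite (_ : gradical a :\ 0 = [set z ^+ (i : 'I_d) * u0 | i : 'I_d]).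
  by rewrite card_zX // add1n prednK // expn_gt0 prime_gt0.
have ss (w : F) : w ^+ (p ^ 2) = w -> (w ^+ s) ^+ s = w.
  by move=> w2; rewrite -exprM -expnD addnn -muln2 frob_iter.
apply/setP=> u; rewrite !inE gold_polar_eq0 addrC addr_eq0.
apply/idP/imsetP => [/andP[u_nz /eqP Eu]|[i _ ->]].
  have [|i ui] := prim_rootP zP (x := u / u0); last by exists i; rewrite // -ui divfK.
  have w0 : u / u0 != 0 by rewrite mulf_neq0 ?invr_neq0.
  apply: (mulfI w0); rewrite -exprS prednK ?expn_gt0 ?prime_gt0 // mulr1.
  have ws : ((u / u0) ^+ s) ^+ s = u / u0.
    have as0 : a ^+ s != 0 by rewrite expf_neq0.
    have au0 : a * u0 != 0 by rewrite mulf_neq0.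
    apply: (mulfI au0); apply: oppr_inj; rewrite -mulNr -Eu0 !expr_div_n -mulrA [(u0 ^+ s) ^+ s *
      _]mulrC divfK.
      by rewrite Eu -mulrA [u0 * _]mulrC divfK.
    by rewrite !expf_neq0.
  have := @frob_gcd m (2 * l) (u / u0) m_gt0; rewrite -{1}[m]mul1n frob_m => /(_ erefl).
  rewrite mul2n -addnn expnD exprM addnn -mul2n {1}m_halfE -muln_gcdr => /(_ ws).
  have /eqP-> : coprime m./2 l by move: ml_coprime; rewrite {1}m_halfE coprimeMl => /andP[].
  by [].
rewrite mulf_neq0 ?expf_neq0 ?z_neq0 //= !exprMn mulrCA Eu0.
by rewrite ss ?zX_frob2 //; apply/eqP; ring.
Qed.

(* With the other sign, [level0_mod] would make p + 1 divide 2, since -p = 1 modulo p + 1. *)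
Lemma dev_sign a i (x : rat) : dev a 0 = (1 - P) * x -> (x == P ^+ i) || (x == - P ^+ i) ->
  x = (- P) ^+ i.
Proof.
move=> dev0 xi; have [c lc] := level0_mod a.
have P3 := P_ge3.
have [//|xN] := eqVneq x ((- P) ^+ i).
have {xi xN} xE : x = - (- P) ^+ i.
  move: xi xN; rewrite exprNn -signr_odd; case: (odd i) => /=; rewrite ?expr1 ?expr0 ?mulN1r ?mul1r;
    by case/orP=> /eqP->; rewrite ?opprK ?eqxx.
have d1 : d%:R = P ^+ 2 - 1 by rewrite -subn1 natrB ?natrX // expn_gt0 prime_gt0.
have k0 := m_half_gt0.
pose p' : int := p%:Z.
have E : p' * (p' ^+ 2) ^+ m./2.-1 + (p' - 1) * (- p') ^+ i = 1 + (p' ^+ 2 - 1) * c%:Z.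
  apply: (@intr_inj rat); rewrite !(rmorphD, rmorphB, rmorphM, rmorphXn, rmorphN, rmorph1) /=.
  rewrite -!pmulrn; move: dev0; rewrite /dev lc natrD natrM d1 xE.
  have -> : P ^+ m.-1 = P * (P ^+ 2) ^+ m./2.-1.
    by rewrite -exprM -exprS; congr (_ ^+ _); rewrite [in LHS]m_halfE; lia.
  by lra.
(* Here p^2 = 1 modulo p^2 - 1 and -p = 1 modulo p + 1. Substituted in [E], and with p - 1
   cancelled, this exhibits 2 as a multiple of p + 1. *)
have [A EA] : exists A, (p' ^+ 2) ^+ m./2.-1 = 1 + (p' ^+ 2 - 1) * A.
  by exists (\sum_(j < m./2.-1) (p' ^+ 2) ^+ j); rewrite -subrX1 addrC subrK.
have [B EB] : exists B, (- p') ^+ i = 1 + (- p' - 1) * B.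
  by exists (\sum_(j < i) (- p') ^+ j); rewrite -subrX1 addrC subrK.
have : (p' - 1) * ((p' + 1) * (c%:Z - p' * A + B) - 2) = 0.
  by move: E; rewrite EA EB => E; transitivity (1 + (p' ^+ 2 - 1) * c%:Z - (p' * (1 + (p' ^+ 2 -
    1) * A) + (p' - 1) * (1 + (- p' - 1) * B))); [ring|rewrite E; ring].
have p3 : (3 <= p)%N by rewrite -(ler_nat rat).
move/eqP; rewrite mulf_eq0 => /orP[/eqP|/eqP]; first by rewrite /p'; lia.
move: (_ + B) => y e; have : (p' + 1 %| (2%:R)%R)%Z.
  by move/eqP: e; rewrite subr_eq0 => /eqP<-; apply: dvdz_mulr.
by rewrite dvdzE => /dvdn_leq -/(_ isT); rewrite /p'; lia.
Qed.

(** The deviation is constant off 0 and sums to 0, so the second moment determines its square;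
    [dev_sign] fixes the sign. *)
Lemma gold_even_spectrum a r : a != 0 -> #|gradical a| = (p ^ (2 * r))%N ->
  dev a 0 = (1 - P) * (- P) ^+ (m./2.-1 + r)
  /\ forall t, t != 0 -> dev a t = (- P) ^+ (m./2.-1 + r).
Proof.
move=> a0 Rr; set i := (_ + r)%N; have P3 := P_ge3.
have k0 := m_half_gt0.
have cardNZ : #|[pred t : 'F_p | t != 0]|%:R = P - 1.
  rewrite -natr_predp; congr (_%:R).
  by rewrite -[in RHS](card_Fp p_pr) -(cardC1 (0 : 'F_p)); apply: eq_card => x; rewrite !inE.
have dev0 : dev a 0 = (1 - P) * dev a 1.
  have := sum_dev a; rewrite (bigD1 0) //= (eq_bigr (fun=> dev a 1)) => [|t]; last exact: dev_neq0.
  by rewrite sumr_const -[_ *+ #|_|]mulr_natl cardNZ; lra.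
have dev1 : dev a 1 = (- P) ^+ i.
  apply: (dev_sign dev0); rewrite -eqf_sqr; apply/eqP.
  have := sum_dev_sqr a; rewrite (bigD1 0) //= (eq_bigr (fun=> dev a 1 ^+ 2)) => [|t t0];
    last by rewrite dev_neq0.
  rewrite sumr_const -[_ *+ #|_|]mulr_natl cardNZ dev0 Rr natrX.
  have -> : P ^+ m.-1 * (P - 1) * P ^+ (2 * r) = P * (P - 1) * (P ^+ i) ^+ 2.
    rewrite [RHS]mulrAC [LHS]mulrAC -exprD -exprM -exprS; congr (_ ^+ _ * _).
    rewrite [in LHS]m_halfE /i; lia.
  move=> E; apply: (@mulfI _ (P * (P - 1))); first by rewrite mulf_neq0 //; apply/eqP; lra.
  rewrite -E; ring.
by rewrite dev0 -dev1; split=> // t; apply: dev_neq0.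
Qed.

Lemma gold_even_spectrum_card a r (v : rat) : a != 0 -> #|gradical a| = (p ^ (2 * r))%N ->
  #|[set t | dev a t == v]|%:R =
  (v == (1 - P) * (- P) ^+ (m./2.-1 + r))%:R + (P - 1) * (v == (- P) ^+ (m./2.-1 + r))%:R :> rat.
Proof.
move=> a0 Rr; have [dev0 dev1] := gold_even_spectrum a0 Rr.
rewrite (cardsD1 0) inE dev0 natrD eq_sym; congr (_ + _).
have [->|vN] := eqVneq v ((- P) ^+ (m./2.-1 + r)).
  rewrite mulr1 -natr_predp; congr (_%:R).
  rewrite -[in RHS](card_Fp p_pr) -(cardC1 (0 : 'F_p)); apply: eq_card => t; rewrite !inE.
  by apply: andb_idr => /dev1->.
rewrite mulr0; apply/eqP; rewrite pnatr_eq0 cards_eq0; apply/set0Pn => -[t].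
by rewrite !inE => /andP[/dev1->]; rewrite eq_sym (negPf vN).
Qed.

End PrimRoot.

(** Counts the pairs (a, x) with tr(a x^(p^l+1)) = 0 in two ways. The q pairs with a = 0 match the q
    pairs with x = 0, and each nonzero x has q / p partners. *)
Lemma sum_dev0 : \sum_(a | a != 0) dev a 0 = 0.
Proof.
have E : (\sum_a glevel a 0%R * p = p * p ^ m + (p ^ m).-1 * p ^ m)%N.
  transitivity (\sum_x #|[set a | tr (a * x ^+ k)%R == 0%R]| * p)%N.
    rewrite -!big_distrl /=; congr (_ * _)%N; rewrite /level.
    under eq_bigr do rewrite -sum1_card; rewrite (exchange_big_dep xpredT) //=.
    apply: eq_bigr => x _; rewrite sum1_card; apply: eq_card => a.
    by rewrite [RHS]inE; apply: (in_set (fun y => gold a y == 0) x).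
  rewrite (bigD1 0) //= (eq_bigr (fun=> p ^ m)%N) => [|x x0].
    have -> : #|[set a | tr (a * 0 ^+ k) == 0]| = (p ^ m)%N.
      by rewrite -cardF; apply: eq_card => a; rewrite inE addn1 exprS mul0r mulr0 (tr0 trZ) eqxx.
    rewrite sum_nat_const mulnC; congr (_ + _ * _)%N.
    by rewrite -cardF -(cardC1 (0 : F)); apply: eq_card => x; rewrite !inE.
  have xk0 : x ^+ k != 0 by rewrite expf_neq0.
  rewrite -cardF -(card_tr_affine p_pr trD tr_nz 0 0 xk0); congr (_ * _)%N.
  by apply: eq_card => a; rewrite !inE add0r mulrC.
have level00 : glevel 0 0 = (p ^ m)%N.
  by rewrite -cardF; apply: eq_card => x; rewrite inE /gold mul0r (tr0 trZ) eqxx.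
have P0 : P != 0 by rewrite pnatr_eq0 -lt0n prime_gt0.
have NZ : #|[pred a : F | a != 0]| = (p ^ m).-1.
  by rewrite -cardF -(cardC1 (0 : F)); apply: eq_card => x; rewrite !inE.
move: E; rewrite (bigD1 0) //= level00 [(p * _)%N]mulnC => /addnI.
rewrite -big_distrl /= => /(congr1 (fun n => n%:R : rat)).
rewrite !natrM natr_sum natrX expP_pred => E; apply: (mulIf P0).
by rewrite /dev sumrB sumr_const NZ mulrBl E -[_ *+ _.-1]mulr_natl mul0r; ring.
Qed.

Definition degenerate : {set F} := [set a | (a != 0) && (#|gradical a| == p ^ 2)%N].

Lemma nondegenerateP a : a != 0 -> a \notin degenerate -> #|gradical a| = (p ^ (2 * 0))%N.
Proof.
have [z zP] := quadratic_prim_root; move=> a0; have [[|[|r]] [// _ Rr]] := card_gold_radical zP a0.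
by rewrite inE a0 Rr muln1 eqxx.
Qed.

Lemma degenerateP a : a \in degenerate -> a != 0 /\ #|gradical a| = (p ^ (2 * 1))%N.
Proof. by rewrite inE => /andP[-> /eqP->]. Qed.

Lemma sum_even (f g : rat) (u : F -> rat) :
    (forall a, a != 0 -> #|gradical a| = (p ^ (2 * 0))%N -> u a = f) ->
    (forall a, a != 0 -> #|gradical a| = (p ^ (2 * 1))%N -> u a = g) ->
  \sum_(a | a != 0) u a = #|degenerate|%:R * g + (P ^+ m - 1 - #|degenerate|%:R) * f.
Proof.
move=> uf ug; rewrite (bigID (mem degenerate)) /=; congr (_ + _).
  rewrite (eq_bigr (fun=> g)) => [|a /andP[_ /degenerateP[a0]]]; last exact: ug.
  rewrite sumr_const mulr_natl; congr (_ *+ _); apply: eq_card => a.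
  by rewrite unfold_in /=; apply: andb_idl => /degenerateP[].
rewrite (eq_bigr (fun=> f)) => [|a /andP[a0 /(nondegenerateP a0)]]; last exact: uf.
rewrite sumr_const -[f *+ _]mulr_natl; congr (_ * _).
have -> : P ^+ m - 1 = (p ^ m - 1)%:R by rewrite natrB ?natrX // expn_gt0 prime_gt0.
rewrite -cardF subn1 -(cardC1 (0 : F)) -(cardID (mem degenerate) (predC1 0)) natrD.
have -> : #|[predI predC1 (0 : F) & degenerate]| = #|degenerate|.
  by apply: eq_card => a; rewrite !inE; apply: andb_idl => /andP[].
rewrite addrAC subrr add0r; congr (_%:R); apply: eq_card => a.
by rewrite -topredE /= !inE andbC.
Qed.

(** The deviation at 0 of a degenerate form is -p times that of a nondegenerate one. As the
    deviations sum to 0, there are p times as many nondegenerate forms as degenerate ones. *)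
Lemma card_degenerate : #|degenerate|%:R * (P + 1) = P ^+ m - 1.
Proof.
have [z zP] := quadratic_prim_root; have P3 := P_ge3.
have := sum_dev0; rewrite (sum_even (f := (1 - P) * (- P) ^+ m./2.-1) (g := (1 - P) * (- P) ^+
  m./2.-1.+1)).
- have : (- P) ^+ m./2.-1 != 0 by rewrite expf_neq0 // oppr_eq0; apply/eqP; lra.
  rewrite exprS; set X := (- P) ^+ _; set D := #|_|%:R => X0 E.
  apply: (mulfI X0); apply: (@mulfI _ (1 - P)); first by apply/eqP; lra.
  apply/eqP; rewrite -subr_eq0; apply/eqP; rewrite -[RHS]oppr0 -E; ring.
- by move=> a a0 /(gold_even_spectrum zP a0)[-> _]; rewrite addn0.
- by move=> a a0 /(gold_even_spectrum zP a0)[-> _]; rewrite addn1.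
Qed.

End EvenDegree.

(** * Weight distribution and designs *)

Local Notation word := (F * F * 'F_p)%type.

Definition ev (t : word) (x : F) : 'F_p := gold t.1.1 x + tr (t.1.2 * x) + t.2.
Definition word_zeros (t : word) : nat := zeros tr (gold t.1.1) t.1.2 t.2.
(** Words are sorted by this deviation: the value v corresponds to the weight p^m - p^(m-1) - v. *)
Definition zdev (t : word) : rat := (word_zeros t)%:R - P ^+ m.-1.

Lemma card_word_supp t : #|word_supp ev t|%:R = P ^+ m - P ^+ m.-1 - zdev t.
Proof.
rewrite /zdev opprB addrA subrK -natrX -cardF.
have -> : word_zeros t = #|~: word_supp ev t|.
  by apply: eq_card => x; rewrite !inE negbK.
by rewrite -(cardsC (word_supp ev t)) natrD addrK.
Qed.

Lemma gold0 x : gold 0 x = 0.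
Proof. by rewrite /gold mul0r (tr0 trZ). Qed.

Lemma gradical0 : gradical 0 = setT.
Proof.
apply/setP=> u; rewrite !inE gold_polar_eq0 mul0r add0r expr0n eqn0Ngt expn_gt0.
by rewrite prime_gt0 // mul0r eqxx.
Qed.

Lemma dev_zero t : dev 0 t = (if t == 0 then P ^+ m else 0) - P ^+ m.-1.
Proof.
congr (_ - _); case: eqP => [->|/eqP t0].
  rewrite -natrX -cardF; congr (_%:R).
  by apply: eq_card => x; rewrite inE gold0 eqxx.
by apply/eqP; rewrite pnatr_eq0 cards_eq0; apply/set0Pn => -[x];
  rewrite inE gold0 eq_sym (negPf t0).
Qed.

Lemma card_gpolar_image a : #|polar_image (gold_polar a)|%:R = P ^+ m / #|gradical a|%:R.
Proof.
have R0 : (0 < #|gradical a|)%N by apply/card_gt0P; exists 0; rewrite inE polar_zero.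
rewrite -natrX -cardF -(card_polar_image (gold_polarD a)) natrM mulfK // pnatr_eq0.
by rewrite -lt0n.
Qed.

(** The two excluded values belong to the constant words, so a = 0 contributes only its (q - 1) p
    words with b nonzero, all of deviation 0. For other a, the b in the polar image yield the
    deviations of the form, and the remaining b yield 0. *)
Lemma card_zdev (v : rat) : v != P ^+ m - P ^+ m.-1 -> v != - P ^+ m.-1 ->
  #|[set t | zdev t == v]|%:R =
   (P ^+ m - 1) * (P * (v == 0)%:R)
   + \sum_(a | a != 0) (P ^+ m / #|gradical a|%:R * #|[set t | dev a t == v]|%:R
             + (P ^+ m - P ^+ m / #|gradical a|%:R) * (P * (v == 0)%:R)).
Proof.
move=> v0 v1; have P0 : (0 < p)%N by rewrite prime_gt0.
have sumE : #|[set t | zdev t == v]|%:R =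
   \sum_a (P ^+ m / #|gradical a|%:R * #|[set t | dev a t == v]|%:R
             + (P ^+ m - P ^+ m / #|gradical a|%:R) * (P * (v == 0)%:R)).
  rewrite (card_fibers _ (fun t => t.1.1)) natr_sum; apply: eq_bigr => a _.
  have := card_zeros_pred p_pr trD trZ tr_nz (goldD a) (gold_polarD a) (gold2 a) p_odd
            (fun n => n%:R - P ^+ m.-1 == v).
  set N := #|_| => E; transitivity (N%:R : rat).
    congr (_%:R); rewrite /N -(card_imset _ (f := fun bh : F * 'F_p => (a, bh.1, bh.2)));
      last first.
      by move=> [b h] [b' h'] [/= -> ->].
    apply: eq_card => -[[a' b] h]; rewrite !inE /=; apply/andP/imsetP => [[zv /eqP aa']|[[b' h']
      + [-> -> ->]]].
      by exists (b, h); rewrite ?inE /= -aa'.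
    by rewrite inE eqxx.
  rewrite E natrD !natrM natrB ?max_card // card_gpolar_image cardF natrX;
    congr (_ + _ * (_ * _%:R)).
  have -> : (p ^ m %/ p)%N = (p ^ m.-1)%N by rewrite -[m in LHS]prednK // expnS mulKn.
  by rewrite natrX subrr eq_sym.
rewrite sumE (bigD1 0) //= gradical0 cardsT cardF natrX divff ?mul1r.
  congr (_ + _); rewrite [X in X%:R + _](_ : _ = 0%N) ?add0r //.
  apply/eqP; rewrite cards_eq0; apply/set0Pn => -[t]; rewrite inE dev_zero.
  by case: ifP => _; rewrite eq_sym ?sub0r ?(negPf v0) ?(negPf v1).
by rewrite expf_neq0 // pnatr_eq0 -lt0n.
Qed.

(** Bounds the weights of all nonzero words from below; the middle case is that of the nonzero
    constants. *)
Lemma zdev_cases t : t != (0, 0, 0) ->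
  [\/ zdev t = 0, zdev t = - P ^+ m.-1 | exists2 a, a != 0 & exists s, zdev t = dev a s].
Proof.
case: t => [[a b] h] t0.
have zdev_im c : b = gold_polar a c -> zdev (a, b, h) = dev a (gold a c - h).
  by move=> bc; rewrite /zdev /word_zeros /= bc (zeros_polar (goldD a)).
have [/imsetP[c _ bc]|bN] := boolP (b \in polar_image (gold_polar a)); last first.
  constructor 1; apply/eqP; rewrite subr_eq0 -natrX eqr_nat /word_zeros /=.
  have := zeros_notin p_pr trD trZ tr_nz (goldD a) (gold_polarD a) (gold2 a) p_odd h bN.
  rewrite cardF -[m in (p ^ m)%N]prednK // expnSr => /eqP.
  by rewrite eqn_pmul2r ?prime_gt0.
have [a0|a0] := eqVneq a 0; last first.
  by constructor 3; exists a => //; exists (gold a c - h); rewrite (zdev_im c).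
constructor 2; rewrite (zdev_im c) // a0 gold0 dev_zero sub0r oppr_eq0.
have b0 : b = 0.
  by apply/eqP; rewrite bc; have := in_setT c; rewrite -gradical0 inE a0.
have h0 : h != 0 by apply: contraNneq t0 => h0; rewrite a0 b0 h0.
by rewrite (negPf h0) sub0r.
Qed.

(** Expanding Q_a(u x + v) gives a form with coefficient a u^(p^l+1), a polar term linear in x, and
    a constant. *)
Lemma ev_affine t u v : exists t', forall x, ev t' x = ev t (u * x + v).
Proof.
case: t => [[a b] h]; exists (a * u ^+ k, gold_polar a v * u + b * u, h + gold a v + tr (b * v))
  => x.
rewrite /ev /= goldD mulrDl !mulrDr !trD /gold exprMn !mulrA; ring.
Qed.

Definition wscale (h : 'F_p) (t : word) : word := (iota h * t.1.1, iota h * t.1.2, h * t.2).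
Definition wcomb (h : 'F_p) (t t' : word) : word :=
  (t.1.1 - iota h * t'.1.1, t.1.2 - iota h * t'.1.2, t.2 - h * t'.2).

Lemma ev_scale h t x : ev (wscale h t) x = h * ev t x.
Proof. by rewrite /ev /gold /= -!mulrA !trZ !mulrDr. Qed.

Lemma ev_comb h t t' x : ev (wcomb h t t') x = ev t x - h * ev t' x.
Proof.
rewrite -ev_scale /ev /gold /wcomb /= !mulrBl !(trB trD trZ); ring.
Qed.

Lemma wcomb_eq h t t' : wcomb h t t' = (0, 0, 0) -> t = wscale h t'.
Proof.
case: t => [[a b] c] /eqP; rewrite !xpair_eqE !subr_eq0 /=.
by case/andP=> /andP[/eqP-> /eqP->] /eqP->.
Qed.

(** With A words of weight i there are A / (p - 1) blocks, and the index follows from the count of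
    pairs of points. *)
Lemma supports_2design_zdev (v A : rat) :
    (forall h, iota h = (h : nat)%:R) -> (forall x, iota (tr x) = Tr charFp x) ->
    #|[set t | zdev t == v]|%:R = A -> 0 < A -> 0 < P ^+ m - P ^+ m.-1 - v ->
    (forall t, t != (0, 0, 0) ->
       (P ^+ m - P ^+ m.-1 - v) * (P - 2) < (P ^+ m - P ^+ m.-1 - zdev t) * (P - 1)) ->
  let i := P ^+ m - P ^+ m.-1 - v in
  supports_2design (code_D2 charFp l) (p ^ m)%N i
    (A * i * (i - 1) / ((P - 1) * P ^+ m * (P ^+ m - 1))).
Proof.
move=> iotaE trE cardA A0 i0 gap i.
have P3 := P_ge3; have p1 := prime_gt1 p_pr.
have /card_gt0P[t0] : (0 < #|[set t | zdev t == v]|)%N by rewrite -(ltr0n rat) cardA.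
rewrite inE => /eqP t0v; pose n := #|word_supp ev t0|.
have nE : n%:R = i by rewrite card_word_supp t0v.
have wordsE : [set t | #|word_supp ev t| == n] = [set t | zdev t == v].
  by apply/setP=> t; rewrite !inE -(eqr_nat rat) nE card_word_supp /i (inj_eq (addrI _)) eqr_opp.
pose cw (t : word) := codeword2 charFp l t.1.1 t.1.2 t.2.
have cwE t x : cw t x = iota (ev t x).
  by rewrite ffunE -trE -iotaE -rmorphD /ev /gold -trD.
have supp_cw t : supp (cw t) = word_supp ev t.
  by apply/setP=> x; rewrite !inE cwE fmorph_eq0.
pose B := [set word_supp ev t | t in [set t | #|word_supp ev t| == n]].
have BE : supports_of_weight (code_D2 charFp l) n = B.
  apply/setP=> X; apply/imsetP/imsetP => [[c]|[t]].
    rewrite inE => /andP[/imsetP[t _ ->]]; rewrite /hweight -/(cw t) supp_cw => tn ->.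
    by exists t; rewrite ?inE.
  rewrite inE => tn ->; exists (cw t); rewrite ?supp_cw //.
  by rewrite inE /hweight supp_cw tn andbT; apply/imsetP; exists t.
have n0 : (0 < n)%N by rewrite -(ltr0n rat) nE.
have gapn t : t != (0, 0, 0) -> (n * (p - 2) < #|word_supp ev t| * (p - 1))%N.
  move=> /gap; rewrite -(ltr_nat rat) !natrM nE card_word_supp !natrB //.
  exact: ltnW.
have cardB := card_supports p_pr ev_scale ev_comb wcomb_eq n0 gapn.
have B_size X : X \in B -> #|X| = n by case/imsetP=> t; rewrite inE => /eqP tn ->.
have B_affine X (u w : F) : X \in B -> u != 0 -> [set x | u * x + w \in X] \in B.
  case/imsetP=> t; rewrite inE => /eqP tn -> u0.
  have [t' t'E] := ev_affine t u w.
  have E : [set x | u * x + w \in word_supp ev t] = word_supp ev t'.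
    by apply/setP=> x; rewrite !inE t'E.
  rewrite E imset_f // inE -E -tn; apply/eqP.
  rewrite -[RHS](card_preimset (f := fun x => u * x + w)); last by move=> x y /addIr/(mulfI u0).
  by apply: eq_card => x; rewrite !inE.
have [mu design muE] := affine_2design B_size B_affine.
exists n, mu; split=> //; last by rewrite BE -cardF.
- have Pm1 : P ^+ m - 1 != 0.
    rewrite -natrX -(natrB _ (_ : 1 <= p ^ m)%N) ?expn_gt0 ?prime_gt0 // pnatr_eq0.
    by rewrite -lt0n subn_gt0 -cardF finNzRing_gt1.
  have Pm0 : P ^+ m != 0 by rewrite expf_neq0 // pnatr_eq0 -lt0n prime_gt0.
  have P10 : P - 1 != 0 by apply/eqP; lra.
  have AE : A = #|B|%:R * (P - 1) by rewrite -cardA -wordsE cardB natrM natrB // prime_gt0.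
  move/(congr1 (fun n => n%:R : rat)): muE; rewrite !natrM cardF -!subn1 !natrB ?expn_gt0
    ?(prime_gt0 p_pr) // natrX nE => muE.
  rewrite AE; apply: (@mulIf _ (P ^+ m * (P ^+ m - 1))); first by rewrite mulf_neq0.
  by rewrite muE; field; rewrite ?Pm0 ?Pm1 ?P10.
- apply/eqP; rewrite -lt0n; apply/card_gt0P; exists (cw t0).
  by rewrite inE /hweight supp_cw eqxx andbT; apply/imsetP; exists t0.
Qed.

(** Leaves [i] and [lambda] free, so that closed forms are matched by separate equations. *)
Lemma supports_2design_zdev_eq (v A i lambda : rat) :
    (forall h, iota h = (h : nat)%:R) -> (forall x, iota (tr x) = Tr charFp x) ->
    i = P ^+ m - P ^+ m.-1 - v ->
    lambda = A * i * (i - 1) / ((P - 1) * P ^+ m * (P ^+ m - 1)) ->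
    #|[set t | zdev t == v]|%:R = A -> 0 < A -> 0 < i ->
    (forall t, t != (0, 0, 0) -> i * (P - 2) < (P ^+ m - P ^+ m.-1 - zdev t) * (P - 1)) ->
  supports_2design (code_D2 charFp l) (p ^ m)%N i lambda.
Proof.
by move=> iotaE trE -> -> cardA A0 i0 gap; apply: supports_2design_zdev.
Qed.

(** * Parameters of the designs *)

Hypotheses (iotaE : forall h, iota h = (h : nat)%:R) (trE : forall x, iota (tr x) = Tr charFp x).
Hypothesis m_ge3 : (3 <= m)%N.

Lemma P_le_exp n : (0 < n)%N -> P <= P ^+ n.
Proof. by move=> n0; rewrite -{1}[P]expr1 ler_weXn2l //; have := P_ge3; lra. Qed.

Lemma sumr_const_nz (x : rat) : \sum_(a : F | a != 0) x = (P ^+ m - 1) * x.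
Proof.
rewrite sumr_const -[x *+ _]mulr_natl; congr (_ * _).
have -> : P ^+ m - 1 = (p ^ m - 1)%:R by rewrite natrB ?natrX // expn_gt0 prime_gt0.
by rewrite -cardF subn1 -(cardC1 (0 : F)); congr (_%:R); apply: eq_card => a; rewrite !inE.
Qed.

Lemma odd_designs : odd m ->
  [/\ supports_2design (code_D2 charFp l) (p ^ m)%N
        (P ^+ m - P ^+ (m - 1))
        ((P ^+ m - P ^+ (m - 1) - 1) * (P ^+ (m - 1) + 1)),
      supports_2design (code_D2 charFp l) (p ^ m)%N
        (P ^+ m - P ^+ (m - 1) + P ^+ ((m - 1)./2))
        (1 / 2 * P ^+ ((m - 1)./2)
           * (P ^+ ((m + 1)./2) - P ^+ ((m - 1)./2) + 1)
           * (P ^+ m - P ^+ (m - 1) + P ^+ ((m - 1)./2) - 1))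
    & supports_2design (code_D2 charFp l) (p ^ m)%N
        (P ^+ m - P ^+ (m - 1) - P ^+ ((m - 1)./2))
        (1 / 2 * P ^+ ((m - 1)./2)
           * (P ^+ ((m + 1)./2) - P ^+ ((m - 1)./2) - 1)
           * (P ^+ m - P ^+ (m - 1) - P ^+ ((m - 1)./2) - 1))].
Proof.
move=> m_odd; have P3 := P_ge3; pose j := m.-1./2; pose X := P ^+ j.
have mj : m = (2 * j).+1.
  by rewrite -[LHS]prednK // mul2n -[in LHS](odd_double_half m.-1) -[odd _]negbK -oddS prednK //
    m_odd.
have j0 : (0 < j)%N by move: m_ge3; rewrite mj; lia.
have EX1 : P ^+ m.-1 = X ^+ 2 by rewrite mj /= mulnC exprM.
have EX : P ^+ m = P * X ^+ 2 by rewrite expP_pred EX1.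
have -> : (m + 1)./2 = j.+1 by rewrite mj; lia.
rewrite !subn1 -/j -/X exprS -/X EX1.
have X3 : P <= X by apply: P_le_exp.
have XX : P * X <= X ^+ 2 by rewrite expr2; nra.
have PXX : 3 * X ^+ 2 <= P * X ^+ 2 by nra.
have X2 : 3 * X <= X ^+ 2 by nra.
have dev_le t : t != (0, 0, 0) -> zdev t <= X.
  case/zdev_cases => [->|->|[a a0 [s ->]]]; [lra|rewrite EX1; nra|].
  have [sp _ _ _] := gold_odd_spectrum m_odd a0.
  have [->|s0] := eqVneq (dev a s) 0; first by lra.
  have [->|s1] := eqVneq (dev a s) X; first by [].
  have [->|s2] := eqVneq (dev a s) (- X); first by lra.
  by have /eqP := sp _ s0 s1 s2; rewrite cards_eq0 => /eqP/setP/(_ s); rewrite !inE eqxx.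
(* Compares the largest block size, (p - 1) X^2 + X, with the least weight allowed by [dev_le], (p -
   1) X^2 - X; the inequality comes down to (2p - 3) X < (p - 1) X^2. *)
have gap (v : rat) : - X <= v -> forall t, t != (0, 0, 0) ->
    (P * X ^+ 2 - X ^+ 2 - v) * (P - 2) < (P ^+ m - P ^+ m.-1 - zdev t) * (P - 1).
  move=> vX t /dev_le tX; rewrite EX1 EX.
  have : (P * X ^+ 2 - X ^+ 2 - v) * (P - 2) <= (P * X ^+ 2 - X ^+ 2 + X) * (P - 2) by nra.
  have : (P * X ^+ 2 - X ^+ 2 - X) * (P - 1) <= (P * X ^+ 2 - X ^+ 2 - zdev t) * (P - 1) by nra.
  have : (P * X ^+ 2 - X ^+ 2 + X) * (P - 2) < (P * X ^+ 2 - X ^+ 2 - X) * (P - 1) by nra.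
  by lra.
have cnt (v c : rat) : (v = 0) \/ (v = X) \/ (v = - X) ->
    (forall a, a != 0 -> #|[set t | dev a t == v]|%:R = c) ->
    #|[set t | zdev t == v]|%:R = (P * X ^+ 2 - 1) * ((if v == 0 then P else 0) + P * X ^+ 2 * c).
  move=> vE vc; rewrite card_zdev; last 2 first.
  - by rewrite EX EX1; apply/eqP; case: vE => [->|[->|->]]; nra.
  - by rewrite EX1; apply/eqP; case: vE => [->|[->|->]]; nra.
  rewrite (eq_bigr (fun=> P ^+ m * c)) => [|a a0]; last first.
    by rewrite gold_radical_odd // cards1 divr1 subrr mul0r addr0 vc.
  by rewrite sumr_const_nz EX; case: (v == 0); rewrite ?mulr1 ?mulr0; ring.
have half (n : nat) : (n * 2 = p - 1)%N -> n%:R = (P - 1) / 2.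
  move/(congr1 (fun n => n%:R : rat)); rewrite natrM natrB ?prime_gt0 // => <-.
  by rewrite mulfK.
have Xm1 : P * X ^+ 2 - 1 != 0 by apply/eqP; nra.
have X0 : X != 0 by apply/eqP; lra.
have P0 : P != 0 by apply/eqP; lra.
have P1 : P - 1 != 0 by apply/eqP; lra.
have Xm1p : 0 < P * X ^+ 2 - 1 by nra.
have c0 := @cnt 0 1 (or_introl erefl).
have c1 := @cnt X ((P - 1) / 2) (or_intror (or_introl erefl)).
have c2 := @cnt (- X) ((P - 1) / 2) (or_intror (or_intror erefl)).
have nX0 : (X == 0) = false by apply/eqP/eqP.
have nX0' : (- X == 0) = false by rewrite oppr_eq0.
rewrite !EX; split.
- apply: (supports_2design_zdev_eq (v := 0) iotaE trE _ _ (c0 _)).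
  + by rewrite EX EX1 subr0.
  + by rewrite EX eqxx; field; rewrite ?P0 ?P1 ?Xm1 ?X0.
  + by move=> a /(gold_odd_spectrum m_odd)[_ -> _ _].
  + by rewrite eqxx; apply: mulr_gt0 => //; nra.
  + by nra.
  + by move=> t /(@gap 0 _); rewrite subr0; apply; lra.
- apply: (supports_2design_zdev_eq (v := - X) iotaE trE _ _ (c2 _)).
  + by rewrite EX EX1 opprK.
  + by rewrite EX nX0'; field; rewrite ?P0 ?P1 ?Xm1 ?X0.
  + by move=> a /(gold_odd_spectrum m_odd)[_ _ _ /half].
  + by rewrite nX0' add0r; apply: mulr_gt0 => //; nra.
  + by nra.
  + by move=> t /(@gap (- X) _); rewrite opprK; apply; lra.
- apply: (supports_2design_zdev_eq (v := X) iotaE trE _ _ (c1 _)).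
  + by rewrite EX EX1.
  + by rewrite EX nX0; field; rewrite ?P0 ?P1 ?Xm1 ?X0.
  + by move=> a /(gold_odd_spectrum m_odd)[_ _ /half].
  + by rewrite nX0 add0r; apply: mulr_gt0 => //; nra.
  + by nra.
  + by move=> t /(@gap X _); apply; lra.
Qed.

Lemma even_designs : ~~ odd m -> let e : rat := (-1) ^+ (m./2) in
  [/\ supports_2design (code_D2 charFp l) (p ^ m)%N
        (P ^+ m - P ^+ (m - 1))
        ((P ^+ m - P ^+ (m - 1) - 1) * (P ^+ (m - 1) - P ^+ (m - 2) + 1)),
      supports_2design (code_D2 charFp l) (p ^ m)%N
        (P ^+ (m./2 - 1) * (P - 1) * (P ^+ (m./2) - e))
        (P ^+ (m./2) * (P ^+ (m./2) - e)
           * (P ^+ (m./2 - 1) * (P - 1) * (P ^+ (m./2) - e) - 1)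
           / (P + 1)),
      supports_2design (code_D2 charFp l) (p ^ m)%N
        (P ^+ (m./2 - 1) * (P ^+ (m./2) * (P - 1) + e))
        (P ^+ (m./2) * (P ^+ (m./2) * (P - 1) + e)
           * (P ^+ (m - 1) * (P - 1) + e * P ^+ (m./2 - 1) - 1)
           / (P + 1)),
      supports_2design (code_D2 charFp l) (p ^ m)%N
        (P ^+ (m./2) * (P - 1) * (P ^+ (m./2 - 1) + e))
        (P ^+ (m./2 - 2) * (P ^+ (m./2 - 1) + e)
           * (P ^+ (m./2) * (P - 1) * (P ^+ (m./2 - 1) + e) - 1)
           / (P + 1))
    & supports_2design (code_D2 charFp l) (p ^ m)%N
        (P ^+ (m./2) * (P ^+ (m./2 - 1) * (P - 1) - e))
        (P ^+ (m./2 - 2) * (P ^+ (m./2 - 1) * (P - 1) - e)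
           * (P ^+ (m - 1) * (P - 1) - e * P ^+ (m./2) - 1)
           / (P + 1))].
Proof.
move=> m_even e; have P3 := P_ge3; pose n := m./2.-1; pose X := P ^+ n.
have [z zP] := quadratic_prim_root m_even.
have mk : m./2 = n.+1 by rewrite prednK // m_half_gt0.
have m2k : m = (2 * n).+2 by rewrite (m_halfE m_even) mk mulnS.
have k0 : (0 < n)%N by move: m_ge3; rewrite m2k; case: (n).
have P0 : P != 0 by apply/eqP; lra.
have EX2 : P ^+ (m - 2) = X ^+ 2 by rewrite m2k subn2 /= mulnC exprM.
have EX1 : P ^+ m.-1 = P * X ^+ 2 by rewrite -EX2 -exprS m2k subn2.
have EX : P ^+ m = P ^+ 2 * X ^+ 2 by rewrite expP_pred EX1; ring.
have EXk : P ^+ (m./2 - 2) = X / P by rewrite mk subSS /X -[in RHS](prednK k0) subn1 exprSr mulfK.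
have eE : (e = 1) \/ (e = -1).
  by rewrite /e -signr_odd; case: (odd _); [right|left]; rewrite ?expr1 ?expr0.
have e0 : e != 0 by case: eE => ->.
have eX : (- P) ^+ n = - e * X by rewrite exprNn /e mk exprS -/X; ring.
have eXS : (- P) ^+ n.+1 = e * (P * X) by rewrite exprS eX; ring.
rewrite EX2 EXk !subn1 -/n mk [P ^+ n.+1]exprS -/X EX1.
have X3 : P <= X by apply: P_le_exp.
(* With X = p^(m/2-1), T is q / p. The deviations are e times Y - X or -X for nondegenerate forms,
   and e times Y - Z or Y for degenerate ones. *)
pose Y := P * X; pose Z := P * Y; pose T := X * Y.
have Y3 : 3 * X <= Y by rewrite /Y; nra.
have Z3 : 3 * Y <= Z by rewrite /Z; nra.
have ZT : Z <= T by rewrite /Z /T; nra.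
have T3 : 3 * T <= P * T by nra.
have PT1 : P * X ^+ 2 = T by rewrite /T /Y; ring.
have PT : P ^+ 2 * X ^+ 2 = P * T by rewrite /T /Y; ring.
have X1p : 0 < P ^+ 2 * X ^+ 2 - 1 by lra.
have Xm1 : P ^+ 2 * X ^+ 2 - 1 != 0 by apply/eqP; lra.
have X0 : X != 0 by apply/eqP; lra.
have P1 : P - 1 != 0 by apply/eqP; lra.
have PS : P + 1 != 0 by apply/eqP; lra.
pose D := (P ^+ 2 * X ^+ 2 - 1) / (P + 1).
have DE : #|degenerate|%:R = D.
  by apply: (mulIf PS); rewrite card_degenerate // EX divfK.
have Dp : 0 < D by apply: divr_gt0 => //; lra.
have DX : P ^+ 2 * X ^+ 2 - 1 - D = P * D by rewrite /D; field.
have zdev_e t : t != (0, 0, 0) -> zdev t <= 0 \/ exists2 c, zdev t = e * c & Y - Z <= c <= Y.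
  case/zdev_cases => [->|->|[a a0 [s ->]]]; [by left|by left; rewrite EX1; lra|right].
  have [[|[|r]] [// _ Rr]] := card_gold_radical m_even zP a0;
    have [d0 d1] := gold_even_spectrum m_even zP a0 Rr;
    have [->|/d1->] := eqVneq s 0; rewrite ?d0 -/n ?addn0 ?addn1 ?eX ?eXS.
  - by exists (Y - X); [rewrite /Y; ring|lra].
  - by exists (- X); [ring|lra].
  - by exists (Y - Z); [rewrite /Z /Y; ring|lra].
  - by exists Y; [|lra].
have gap (c : rat) : Y - Z <= c <= Y -> forall t, t != (0, 0, 0) ->
    (P * T - T - e * c) * (P - 2) < (P ^+ m - P ^+ m.-1 - zdev t) * (P - 1).
  move=> cYZ t /zdev_e tz; rewrite EX1 EX PT PT1.
  have PYT : 0 <= (P - 1) * (T - P * Y) by apply: mulr_ge0; [lra|rewrite -/Z; lra].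
  have PY : 0 < (P - 1) * Y by apply: mulr_gt0; lra.
  (* V bounds the excess of the block size over (p - 1) T, and U the shortfall of any nonzero word;
     the sign e decides which end of the interval from Y - Z to Y gives which bound. *)
  have [V [U [Vc Uz VU]]] : exists V U, [/\ - (e * c) <= V, zdev t <= U &
      V * (P - 2) + U * (P - 1) < P * T - T].
    case: eE tz => -> tz; [exists (Z - Y), Y|exists Y, (Z - Y)]; split.
    - lra.
    - by case: tz => [|[c' -> ?]]; lra.
    - by rewrite /Z; lra.
    - lra.
    - by case: tz => [|[c' -> ?]]; lra.
    - by rewrite /Z; lra.
  have : (P * T - T - e * c) * (P - 2) <= (P * T - T + V) * (P - 2) by nra.
  have : (P * T - T - U) * (P - 1) <= (P * T - T - zdev t) * (P - 1) by nra.
  have : (P * T - T + V) * (P - 2) < (P * T - T - U) * (P - 1) by nra.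
  by lra.
have ec c : Y - Z <= c <= Y -> Y - Z <= e * c <= Z - Y by case: eE => ->; lra.
(* The three groups come from a = 0, from the D degenerate forms, whose polar image has q / p^2 =
   X^2 elements, and from the p D nondegenerate ones, whose polar image is all of [F]. *)
have cnt (c : rat) : Y - Z <= c <= Y -> #|[set t | zdev t == e * c]|%:R =
    (P ^+ 2 * X ^+ 2 - 1) * (if c == 0 then P else 0)
    + (D * (X ^+ 2 * ((if c == Y - Z then 1 else 0) + (P - 1) * (if c == Y then 1 else 0))
            + (P ^+ 2 * X ^+ 2 - X ^+ 2) * (if c == 0 then P else 0))
       + P * D * (P ^+ 2 * X ^+ 2 * ((if c == Y - X then 1 else 0)
                                       + (P - 1) * (if c == - X then 1 else 0)))).
  move=> cYZ; have := ec _ cYZ => ecYZ.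
  have tst c' : (e * c == e * c') = (c == c') by rewrite (inj_eq (mulfI e0)).
  have b2n (b : bool) : b%:R = (if b then 1 else 0) :> rat by case: b.
  have pif : P * (e * c == 0)%:R = (if c == 0 then P else 0).
    by rewrite -[in LHS](mulr0 e) tst; case: (c == 0); rewrite ?mulr1 ?mulr0.
  rewrite card_zdev; last 2 first.
  - by rewrite EX EX1; apply/eqP; lra.
  - by rewrite EX1; apply/eqP; lra.
  rewrite pif EX; congr (_ + _); rewrite -DX -DE -EX; apply: sum_even => // a a0 Rr.
  - rewrite Rr (gold_even_spectrum_card m_even zP _ a0 Rr) addn0 -/n eX EX natrX expr0 divr1
    subrr mul0r addr0.
    have -> : (1 - P) * (- e * X) = e * (Y - X) by rewrite /Y; ring.
    by rewrite mulNr -mulrN !tst !b2n.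
  - rewrite Rr (gold_even_spectrum_card m_even zP _ a0 Rr) addn1 -/n eXS EX muln1 natrX.
    rewrite [P ^+ 2 * X ^+ 2 / _]mulrAC mulfV ?expf_neq0 // mul1r.
    have -> : (1 - P) * (e * (P * X)) = e * (Y - Z) by rewrite /Z /Y; ring.
    by rewrite !tst !b2n.
rewrite !EX.
have fld := (P0, P1, PS, Xm1, X0).
have tests := even_dev_neq (lt_le_trans (ltr0Sn _ 2) (le_trans P3 X3)) Y3 Z3.
have P1p : 0 < P - 1 by lra.
have DX1 : 0 < D * X ^+ 2 by apply: mulr_gt0 => //; apply: exprn_gt0; lra.
have DX2 : 0 < P * D * (P ^+ 2 * X ^+ 2) by apply: mulr_gt0; [apply: mulr_gt0 => //|]; lra.
have DX3 := mulr_gt0 DX1 P1p.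
have DX4 := mulr_gt0 DX2 P1p.
(* The five block sizes belong, in this order, to c = 0, Y - X, -X, Y - Z and Y. *)
split.
- apply: (supports_2design_zdev_eq (v := e * 0) iotaE trE _ _ (cnt _ _)).
  + by rewrite EX EX1 mulr0 subr0.
  + by rewrite EX eqxx !tests /D; field; rewrite ?exprMn ?fld.
  + by lra.
  + by rewrite eqxx !tests; nra.
  + by lra.
  + by rewrite PT PT1; move=> t /(@gap 0 _); rewrite mulr0 subr0; apply; lra.
- have iE : X * (P - 1) * (P * X - e) = P * T - T - e * (Y - X) by rewrite /T /Y; ring.
  apply: (supports_2design_zdev_eq (v := e * (Y - X)) iotaE trE _ _ (cnt _ _)).
  + by rewrite iE EX EX1 PT PT1.
  + by rewrite EX eqxx !tests /D; field; rewrite ?exprMn ?fld.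
  + by lra.
  + by rewrite eqxx !tests; lra.
  + by rewrite iE; have := ec (Y - X); lra.
  + by rewrite iE; apply: gap; lra.
- have iE : X * (P * X * (P - 1) + e) = P * T - T - e * (- X) by rewrite /T /Y; ring.
  apply: (supports_2design_zdev_eq (v := e * (- X)) iotaE trE _ _ (cnt _ _)).
  + by rewrite iE EX EX1 PT PT1.
  + by rewrite EX eqxx !tests /D; field; rewrite ?exprMn ?fld.
  + by lra.
  + by rewrite eqxx !tests; lra.
  + by rewrite iE; have := ec (- X); lra.
  + by rewrite iE; apply: gap; lra.
- have iE : P * X * (P - 1) * (X + e) = P * T - T - e * (Y - Z) by rewrite /T /Z /Y; ring.
  apply: (supports_2design_zdev_eq (v := e * (Y - Z)) iotaE trE _ _ (cnt _ _)).
  + by rewrite iE EX EX1 PT PT1.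
  + by rewrite EX eqxx !tests /D; field; rewrite ?exprMn ?fld.
  + by lra.
  + by rewrite eqxx !tests; lra.
  + by rewrite iE; have := ec (Y - Z); lra.
  + by rewrite iE; apply: gap; lra.
- have iE : P * X * (X * (P - 1) - e) = P * T - T - e * Y by rewrite /T /Y; ring.
  apply: (supports_2design_zdev_eq (v := e * Y) iotaE trE _ _ (cnt _ _)).
  + by rewrite iE EX EX1 PT PT1.
  + by rewrite EX eqxx !tests /D; field; rewrite ?exprMn ?fld.
  + by lra.
  + by rewrite eqxx !tests; lra.
  + by rewrite iE; have := ec Y; lra.
  + by rewrite iE; apply: gap; lra.
Qed.

End TraceForm.

Theorem theorem4p7 (p m l : nat) (F : finFieldType)
    (p_prime : prime p) (p_odd : odd p) (m_ge3 : (3 <= m)%N)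
    (l_gt0 : (0 < l)%N) (ml_coprime : gcdn m l = 1%N)
    (cardF : #|F| = (p ^ m)%N) (charFp : p \in [pchar F]) :
  let D2 := code_D2 charFp l in
  let P : rat := p%:R in
  let e : rat := (-1) ^+ (m./2) in
  (odd m ->
    [/\ supports_2design D2 (p ^ m)%N
          (P ^+ m - P ^+ (m - 1))
          ((P ^+ m - P ^+ (m - 1) - 1) * (P ^+ (m - 1) + 1)),
        supports_2design D2 (p ^ m)%N
          (P ^+ m - P ^+ (m - 1) + P ^+ ((m - 1)./2))
          (1 / 2 * P ^+ ((m - 1)./2)
             * (P ^+ ((m + 1)./2) - P ^+ ((m - 1)./2) + 1)
             * (P ^+ m - P ^+ (m - 1) + P ^+ ((m - 1)./2) - 1))
      & supports_2design D2 (p ^ m)%N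
          (P ^+ m - P ^+ (m - 1) - P ^+ ((m - 1)./2))
          (1 / 2 * P ^+ ((m - 1)./2)
             * (P ^+ ((m + 1)./2) - P ^+ ((m - 1)./2) - 1)
             * (P ^+ m - P ^+ (m - 1) - P ^+ ((m - 1)./2) - 1))]) /\
  (~~ odd m -> (4 <= m)%N ->
    [/\ supports_2design D2 (p ^ m)%N
          (P ^+ m - P ^+ (m - 1))
          ((P ^+ m - P ^+ (m - 1) - 1) * (P ^+ (m - 1) - P ^+ (m - 2) + 1)),
        supports_2design D2 (p ^ m)%N
          (P ^+ (m./2 - 1) * (P - 1) * (P ^+ (m./2) - e))
          (P ^+ (m./2) * (P ^+ (m./2) - e)
             * (P ^+ (m./2 - 1) * (P - 1) * (P ^+ (m./2) - e) - 1)
             / (P + 1)),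
        supports_2design D2 (p ^ m)%N
          (P ^+ (m./2 - 1) * (P ^+ (m./2) * (P - 1) + e))
          (P ^+ (m./2) * (P ^+ (m./2) * (P - 1) + e)
             * (P ^+ (m - 1) * (P - 1) + e * P ^+ (m./2 - 1) - 1)
             / (P + 1)),
        supports_2design D2 (p ^ m)%N
          (P ^+ (m./2) * (P - 1) * (P ^+ (m./2 - 1) + e))
          (P ^+ (m./2 - 2) * (P ^+ (m./2 - 1) + e)
             * (P ^+ (m./2) * (P - 1) * (P ^+ (m./2 - 1) + e) - 1)
             / (P + 1))
      & supports_2design D2 (p ^ m)%N
          (P ^+ (m./2) * (P ^+ (m./2 - 1) * (P - 1) - e))
          (P ^+ (m./2 - 2) * (P ^+ (m./2 - 1) * (P - 1) - e)
             * (P ^+ (m - 1) * (P - 1) - e * P ^+ (m./2) - 1)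
             / (P + 1))]).
Proof.
move=> D2 P e.
have [iota [tr [iotaE trE trD trZ [trX tr_nz]]]] := prime_field_trace charFp.
have m_gt0 : (0 < m)%N by apply: leq_trans m_ge3.
have ml : coprime m l by apply/eqP.
split=> [m_odd|m_even _].
  by apply: (@odd_designs p m l F iota tr).
by apply: (@even_designs p m l F iota tr).
Qed.
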